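(* Run Approximate TD-PMD (defined in the context) with behavior policy $\pi_b$. Suppose that: (i) $\tilde\pi_b:=\min_{(s,a)\in\mathcal S\times\mathcal A}\pi_b(a|s)>0$; (ii) for every $\pi\in\Pi$ the state transition matrix $P^{\pi_b\circ\pi}_{\mathcal S}$ is ergodic over $\mathcal S$; (iii) the mirror map $h$ is $\lambda$-strongly convex with respect to the $\ell_p$-norm over $\Delta(\mathcal A)$, where $p\in[1,+\infty]$ is some constant. Let $$\eta_k=\eta=\sqrt{\frac{\alpha\lambda\tilde\sigma^2(1-\gamma)^4\|D^{\pi^*}_{\pi_0}\|_\infty}{(6+4L)|\mathcal A|^2(K+1)}},\qquad \alpha_k=\alpha\in(0,1],\qquad B_k=B>0,$$ where $L:=|\mathcal A|\big(\lceil\log_\kappa m^{-1}\rceil+(1-\kappa)^{-1}\big)$, and let the weights be $c_t^k=\vartheta^{B_k-t-1}\big/\sum_{i=0}^{B_k-1}\vartheta^{i}$ for a preset parameter $\vartheta\in[0,1]$ (with the convention $0^0=1$). Fixing any optimal policy $\pi^*\in\Pi^*$ and $\mu\in\Delta(\mathcal S)$, there holds $$\mathbb E\big[V^*(\mu)-V^{\pi_{\hat K}}(\mu)\big]\le \frac{1}{K+1}\cdot\frac{3}{\alpha\tilde\sigma(1-\gamma)^3}+\frac{2}{\sqrt{K+1}}\left(\frac{(6+4L)|\mathcal A|^2\|D^{\pi^*}_{\pi_0}\|_\infty}{\alpha\lambda\tilde\sigma^2(1-\gamma)^6}\right)^{1/2}+\frac{2}{\tilde\sigma(1-\gamma)^2}\Psi(B,\vartheta,m,\kappa),$$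 where $\hat K$ is a random index sampled uniformly from $\{0,1,\dots,K\}$ and $$\Psi(B,\vartheta,m,\kappa)=\begin{cases}\dfrac{m}{(1-\gamma)(\kappa-\vartheta)}\,\kappa^{B},&0\le\vartheta<\kappa,\\[1em]\dfrac{m}{1-\gamma}\,B\,\vartheta^{B-1},&\vartheta=\kappa,\\[1em]\dfrac{m}{(1-\gamma)(\vartheta-\kappa)}\,\vartheta^{B},&\kappa<\vartheta<1,\\[1em]\dfrac{m}{B(1-\gamma)(1-\kappa)},&\vartheta=1.\end{cases}$$
   Context: MDP: $\mathcal S,\mathcal A$ are the finite state and action spaces, $P(\cdot|s,a)\in\Delta(\mathcal S)$ is the transition kernel, $r:\mathcal S\times\mathcal A\to[0,1]$ the reward, $\gamma\in[0,1)$ the discount factor; $\Delta(X)$ is the set of probability distributions on $X$. A policy is $\pi:\mathcal S\to\Delta(\mathcal A)$; $\Pi$ is the set of all policies. $V^\pi(s)=\mathbb E[\sum_{t\ge0}\gamma^t r(s_t,a_t)\mid s_0=s,\pi]$, $V^\pi(\mu)=\mathbb E_{s\sim\mu}[V^\pi(s)]$, $V^*(s)=\max_{\pi\in\Pi}V^\pi(s)$, $V^*(\mu)=\mathbb E_{s\sim\mu}[V^*(s)]$, and $\Pi^*=\{\pi\in\Pi: V^\pi=V^*\}$. Mirror map: $h$ is a proper, closed, strictly convex, essentially smooth function with $\mathrm{rint\,dom}(h)\cap\Delta(\mathcal A)\neq\emptyset$. $D_h(p\|q)=h(p)-h(q)-\langle\nabla h(q),p-q\rangle$ is its Bregman divergence;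 $D^{\pi}_{\pi'}(s)=D_h(\pi(\cdot|s)\|\pi'(\cdot|s))$, $D^{p}_{\pi'}(s)=D_h(p\|\pi'(\cdot|s))$, $\|D^\pi_{\pi'}\|_\infty=\max_s D^\pi_{\pi'}(s)$. Approximate TD-PMD. Inputs: number of iterations $K$, behavior policy $\pi_b$, initial action value $Q^0=0\in\mathbb R^{|\mathcal S||\mathcal A|}$, initial policy $\pi_0$, critic step sizes $\alpha_k$, policy step sizes $\eta_k>0$, initial state $s_0$, batch sizes $B_k$, weights $c_t^k\ge0$ with $\sum_{t=0}^{B_k-1}c^k_t=1$. Set $s_0^0=s_0$. For $k=0,1,\dots,K$: (1) for every $s$, $\pi_{k+1}(\cdot|s)=\arg\max_{p\in\Delta(\mathcal A)}\{\eta_k\langle p,Q^k(s,\cdot)\rangle-D^p_{\pi_k}(s)\}$; (2) starting from $s_0^k$ sample, for $t=0,\dots,B_k-1$, $a_t^k\sim\pi_b(\cdot|s_t^k)$, $r_t^k=r(s_t^k,a_t^k)$, $s_t^{\prime k}\sim P(\cdot|s_t^k,a_t^k)$, $a_t^{\prime k}\sim\pi_{k+1}(\cdot|s_t^{\prime k})$, $s_{t+1}^k\sim P(\cdot|s_t^{\prime k},a_t^{\prime k})$, and set $s_0^{k+1}=s_{B_k}^k$; (3) with $\delta_t^k(s,a)=\mathbf 1_{(s_t^k,a_t^k)=(s,a)}\big[r_t^k+\gamma Q^k(s_t^{\prime k},a_t^{\prime k})-Q^k(s_t^k,a_t^k)\big]$ and $\bar\delta_k=\sum_{t=0}^{B_k-1}c_t^k\delta_t^k$,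 set $Q^{k+1}=Q^k+\alpha_k\bar\delta_k$. Composed chains: $P^{\pi}_{\mathcal S}(s,s')=\sum_a\pi(a|s)P(s'|s,a)$ and $P^{\pi_b\circ\pi}_{\mathcal S}=P^{\pi_b}_{\mathcal S}P^{\pi}_{\mathcal S}$. Under assumption (ii), each $P^{\pi_b\circ\pi}_{\mathcal S}$ has a unique stationary distribution $\nu^{\pi_b\circ\pi}$, the entries of these are bounded below by a positive constant uniformly over $\pi$, and there exist constants $m>0$ and $\kappa\in(0,1)$, independent of $\pi$, such that the Markov chain $\{s_t\}$ with kernel $P^{\pi_b\circ\pi}_{\mathcal S}$ satisfies $d_{TV}(\nu^{\pi_b\circ\pi}(\cdot),\mathbb P(s_{n+t}=\cdot\mid s_n=s))\le m\kappa^t$ for all $s\in\mathcal S$, $n,t\ge0$, $\pi\in\Pi$, where $d_{TV}$ is the total variation distance; $m,\kappa$ denote these constants. $\sigma^{\pi_b\circ\pi}(s,a)=\nu^{\pi_b\circ\pi}(s)\pi_b(a|s)$ and $\tilde\sigma=\min_{\pi\in\Pi}\min_{(s,a)}\sigma^{\pi_b\circ\pi}(s,a)>0$.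
   Formalization: If there is only one state, L ≥ 0 is additionally required: then every m > 0 satisfies the mixing bound, so L can be so negative that 6+4L < 0 and η and the bound are undefined; with at least two states L ≥ 0 holds automatically. *)

(* Defs.v *)
From HB Require Import structures.
From mathcomp Require Import all_boot all_order all_algebra.
From mathcomp Require Import all_classical all_reals all_analysis.

Set Implicit Arguments.
Unset Strict Implicit.
Unset Printing Implicit Defensive.

Import Order.TTheory GRing.Theory Num.Theory.
Import numFieldNormedType.Exports.

Local Open Scope classical_set_scope.
Local Open Scope ring_scope.

Record fdist (R : realType) (T : finType) := FDist {
  fdist_pmf :> T -> R;
  fdist_ge0 : forall x, 0 <= fdist_pmf x;
  fdist_sum1 : \sum_x fdist_pmf x = 1 }.

HB.instance Definition _ R T := gen_eqMixin (fdist R T).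
HB.instance Definition _ R T := gen_choiceMixin (fdist R T).

Definition policy (R : realType) (S A : finType) := S -> fdist R A.

Record mdp (R : realType) (S A : finType) := MDP {
  trans : S -> A -> fdist R S;
  reward : S -> A -> R;
  discount : R;
  reward_ge0 : forall s a, 0 <= reward s a;
  reward_le1 : forall s a, reward s a <= 1;
  discount_ge0 : 0 <= discount;
  discount_lt1 : discount < 1 }.

Section Values.
Context {R : realType} {S A : finType}.
Variable M : mdp R S A.

(* A horizon-n trajectory from s0 is encoded by w = ((a_0,s_1),...,(a_{n-1},s_n));
   [traj_state s0 w t] is s_t. *)
Definition traj_state (s0 : S) (w : seq (A * S)) (t : nat) : S :=
  nth s0 (s0 :: map snd w) t.

Definition traj_law (pi : policy R S A) (s0 : S) n (w : n.-tuple (A * S)) : R :=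
  \prod_(t < n) (pi (traj_state s0 w t) (tnth w t).1 *
    trans M (traj_state s0 w t) (tnth w t).1 (tnth w t).2).

Definition traj_return (s0 : S) n (w : n.-tuple (A * S)) : R :=
  \sum_(t < n) discount M ^+ t * reward M (traj_state s0 w t) (tnth w t).1.

(* The expected infinite discounted return, as the limit over the horizon n of
   the expectation of the first n terms. *)
Definition value (pi : policy R S A) (s : S) : R :=
  limn (fun n => \sum_(w : n.-tuple (A * S)) traj_law pi s w * traj_return s w).

Definition opt_value (s : S) : R := sup [set value pi s | pi in [set: policy R S A]].

Definition optimal_policy (pi : policy R S A) : Prop :=
  forall s, value pi s = opt_value s.

Definition mean_at (mu : fdist R S) (V : S -> R) : R := \sum_s mu s * V s.

End Values.

Section Chains.
Context {R : realType} {S A : finType}.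
Implicit Types K : S -> S -> R.

Definition kcomp K K' : S -> S -> R := fun s s' => \sum_u K s u * K' u s'.

Fixpoint kpow K (t : nat) : S -> S -> R :=
  if t is t'.+1 then kcomp K (kpow K t') else fun s s' => (s == s')%:R.

Definition state_kernel (M : mdp R S A) (pi : policy R S A) : S -> S -> R :=
  fun s s' => \sum_a pi s a * trans M s a s'.

Definition composed_kernel (M : mdp R S A) (pi_b pi : policy R S A) : S -> S -> R :=
  kcomp (state_kernel M pi_b) (state_kernel M pi).

Definition irreducible_kernel K : Prop :=
  forall s s', exists t, 0 < kpow K t s s'.

(* the gcd of the return times of each state is 1 *)
Definition aperiodic_kernel K : Prop :=
  forall s (d : nat),
    (forall t, (0 < t)%N -> 0 < kpow K t s s -> (d %| t)%N) -> d = 1%N.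

Definition ergodic_kernel K : Prop := irreducible_kernel K /\ aperiodic_kernel K.

Definition stationary K (nu : fdist R S) : Prop :=
  forall s', \sum_s nu s * K s s' = nu s'.

Definition tv_dist (p q : S -> R) : R := 2^-1 * \sum_s `|p s - q s|.

(* [nu pi] is meant to be the stationary distribution of the kernel composed
   with [pi]; the infimum is the minimum over policies and state-action pairs. *)
Definition sigma_min (pi_b : policy R S A) (nu : policy R S A -> fdist R S) : R :=
  inf [set x | exists (pi : policy R S A) s a, x = nu pi s * pi_b s a].

End Chains.

Section MirrorMaps.
Context {R : realType} {n : nat}.
Implicit Types (h : 'rV[R]_n -> \bar R) (C : set 'rV[R]_n).

Definition edom h : set 'rV[R]_n := [set x | (h x < +oo)%E].

Definition proper_fun h : Prop := (forall x, h x != -oo%E) /\ edom h !=set0.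

Definition strictly_convex h : Prop :=
  forall x y (t : R), edom h x -> edom h y -> x != y -> 0 < t < 1 ->
    (h (t *: x + (1 - t) *: y)%R < t%:E * h x + (1 - t)%:E * h y)%E.

Definition grad h (x : 'rV[R]_n) : 'rV[R]_n :=
  \row_i derive (fine \o h) x (delta_mx 0 i).

Definition dotp (x y : 'rV[R]_n) : R := \sum_i x 0 i * y 0 i.

(* Rockafellar, Convex Analysis, Section 26 *)
Definition essentially_smooth h : Prop :=
  [/\ (edom h)^° !=set0,
      (forall x, (edom h)^° x -> differentiable (fine \o h : _ -> R) x) &
      forall (x : nat -> 'rV[R]_n) (l : 'rV[R]_n),
        (forall k, (edom h)^° (x k)) -> x @ \oo --> l -> ~ (edom h)^° l ->
        `|grad h (x k)| @[k --> \oo] --> +oo].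

Definition affine_hull C : set 'rV[R]_n :=
  [set x | exists k (t : 'I_k -> R) (y : 'I_k -> 'rV[R]_n),
    [/\ forall i, C (y i), \sum_i t i = 1 & x = \sum_i t i *: y i]].

Definition rint C : set 'rV[R]_n :=
  [set x | C x /\ exists2 e : R, 0 < e & ball x e `&` affine_hull C `<=` C].

(* Meaningful for [q] in the interior of [edom h]; it is +oo when [p] is not in
   [edom h]. *)
Definition bregman h (p q : 'rV[R]_n) : \bar R :=
  (h p - h q - (dotp (grad h q) (p - q)%R)%:E)%E.

(* The l_p norm for p in [1, +oo]. *)
Definition lp_norm (p : \bar R) (x : 'rV[R]_n) : R :=
  if p is r%:E%E then (\sum_i `|x 0 i| `^ r) `^ r^-1
  else \big[Num.max/0]_i `|x 0 i|.

End MirrorMaps.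

Section MirrorDescent.
Context {R : realType} {S A : finType}.
Implicit Types (h : 'rV[R]_#|A| -> \bar R) (Q : S -> A -> R) (pi : policy R S A).

Definition vec (p : A -> R) : 'rV[R]_#|A| := \row_i p (enum_val i).

Definition mirror_map h : Prop :=
  [/\ proper_fun h, lower_semicontinuous h, strictly_convex h,
      essentially_smooth h & exists p : fdist R A, rint (edom h) (vec p)].

Definition strongly_convex_simplex h (lam : R) (p : \bar R) : Prop :=
  forall (x y : fdist R A) (t : R), 0 <= t <= 1 ->
    (h (t *: vec x + (1 - t) *: vec y)%R
       + (lam / 2 * t * (1 - t) * lp_norm p (vec x - vec y)%R ^+ 2)%:E
     <= t%:E * h (vec x) + (1 - t)%:E * h (vec y))%E.

Definition policy_bregman h pi pi' (s : S) : \bar R :=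
  bregman h (vec (pi s)) (vec (pi' s)).

Definition policy_bregman_max h pi pi' : \bar R :=
  \big[maxe/-oo%E]_s policy_bregman h pi pi' s.

Definition pmd_objective h (eta : R) Q pi (s : S) (p : fdist R A) : \bar R :=
  ((eta * \sum_a p a * Q s a)%:E - bregman h (vec p) (vec (pi s)))%E.

(* If [vec (pi s)] is in the interior of the domain of a mirror map, the maximizer
   exists and is unique; the default [pi s] is then irrelevant. *)
Definition pmd_update h (eta : R) Q pi : policy R S A := fun s =>
  xget (pi s) [set p | forall q : fdist R A,
    (pmd_objective h eta Q pi s q <= pmd_objective h eta Q pi s p)%E].

End MirrorDescent.

Section ApproximateTDPMD.
Context {R : realType} {S A : finType}.
Variables (M : mdp R S A) (h : 'rV[R]_#|A| -> \bar R) (pi_b : policy R S A).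
Variables (eta alpha : R) (B : nat) (c : nat -> R).

(* (a_t, s'_t, a'_t, s_{t+1}) *)
Definition sample := (A * S * A * S)%type.
Definition smp_a (x : sample) : A := x.1.1.1.
Definition smp_s' (x : sample) : S := x.1.1.2.
Definition smp_a' (x : sample) : A := x.1.2.
Definition smp_next (x : sample) : S := x.2.

Definition batch := B.-tuple sample.

(* s_t, for a batch started at s0 *)
Definition batch_state (s0 : S) (w : batch) (t : nat) : S :=
  nth s0 (s0 :: map smp_next w) t.

Definition batch_law (pi : policy R S A) (s0 : S) (w : batch) : R :=
  \prod_(t < B)
    let s := batch_state s0 w t in let x := tnth w t in
    pi_b s (smp_a x) * trans M s (smp_a x) (smp_s' x) *
    pi (smp_s' x) (smp_a' x) * trans M (smp_s' x) (smp_a' x) (smp_next x).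

Definition td_error (Q : S -> A -> R) (s0 : S) (w : batch) (t : 'I_B)
    (s : S) (a : A) : R :=
  let st := batch_state s0 w t in let x := tnth w t in
  if (st, smp_a x) == (s, a) then
    reward M st (smp_a x) + discount M * Q (smp_s' x) (smp_a' x) - Q st (smp_a x)
  else 0.

Record alg_state := AlgState {
  alg_Q : S -> A -> R;
  alg_pi : policy R S A;
  alg_s : S }.

Definition next_policy (x : alg_state) : policy R S A :=
  pmd_update h eta (alg_Q x) (alg_pi x).

Definition alg_step (x : alg_state) (w : batch) : alg_state :=
  AlgState
    (fun s a => alg_Q x s a
       + alpha * \sum_(t < B) c t * td_error (alg_Q x) (alg_s x) w t s a)
    (next_policy x)
    (batch_state (alg_s x) w B).

(* (Q^k, pi_k, s_0^k) when the successive batches are those listed in [ws] *)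
Definition alg_at (pi_0 : policy R S A) (s_0 : S) (ws : seq batch) (k : nat) :
    alg_state :=
  foldl alg_step (AlgState (fun _ _ => 0) pi_0 s_0) (take k ws).

Definition run_law (pi_0 : policy R S A) (s_0 : S) (K : nat)
    (ws : K.+1.-tuple batch) : R :=
  \prod_(k < K.+1) let x := alg_at pi_0 s_0 ws k in
    batch_law (next_policy x) (alg_s x) (tnth ws k).

(* Expectation over the run and over an independent uniform index in {0,...,K}
   of a function of the policy with that index. *)
Definition expect_random_iterate (pi_0 : policy R S A) (s_0 : S) (K : nat)
    (f : policy R S A -> R) : R :=
  \sum_(x : K.+1.-tuple batch * 'I_K.+1)
    run_law pi_0 s_0 x.1 / K.+1%:R * f (alg_pi (alg_at pi_0 s_0 x.1 x.2)).

End ApproximateTDPMD.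

(* [0 ^+ 0 = 1], so [th = 0] puts all the weight on [t = B - 1]. *)
Definition geometric_weight (R : realType) (B : nat) (th : R) (t : nat) : R :=
  th ^+ (B - t - 1) / \sum_(i < B) th ^+ i.

Definition Psi (R : realType) (gamma : R) (B : nat) (th m kappa : R) : R :=
  if th < kappa then m / ((1 - gamma) * (kappa - th)) * kappa ^+ B
  else if th == kappa then m / (1 - gamma) * B%:R * th ^+ (B - 1)
  else if th < 1 then m / ((1 - gamma) * (th - kappa)) * th ^+ B
  else m / (B%:R * (1 - gamma) * (1 - kappa)).

(* Main.v *)
Require Import Defs.
From mathcomp Require Import all_boot all_order all_algebra.
From mathcomp Require Import all_classical all_reals all_analysis.
From mathcomp Require Import finmap zify ring lra.

(* Let x stand for the state (Q^k, pi_k, s_0^k) of the algorithm, pi_+ for the next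
   policy, which is a function of x, and d for the discounted occupancy measure of
   pi_star started at mu, of total mass 1 / (1 - gamma). By the performance difference
   lemma the suboptimality of a policy pi at mu is <w_pi, Q^pi> with
   w_pi(s, a) = d(s) (pi_star - pi)(a|s). Write v_pi for the solution of
   v = w_pi + gamma (P^pi)^T v and u_pi = v_pi / sigma^pi. Then
     <w_pi, Q^pi> = <w_pi, Q> + <v_pi, T^pi Q - Q>,
   and <v_pi, T^pi Q - Q> is, for pi = pi_+ and up to the mixing bias, the conditional
   expectation of <u_pi, Q^{k+1} - Q^k> / alpha. The first term is controlled by mirror
   descent, the second telescopes up to the drift of u, so that
     Phi(x) = (1/eta) sum_s d(s) D_h(pi_star(.|s) || pi_k(.|s)) - <u_{pi_k}, Q^k> / alpha
   satisfies gap(pi_+) <= Phi(x) - E Phi(next x) + O(eta) + bias. No variance enters,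
   because only a linear functional of Q^k is tracked. The drift of u is O(eta): strong
   convexity makes successive policies close, and mixing makes the stationary
   distribution Lipschitz in the policy. *)

Set Implicit Arguments.
Unset Strict Implicit.
Unset Printing Implicit Defensive.

Import Order.TTheory GRing.Theory Num.Theory.
Import numFieldNormedType.Exports.

Local Open Scope classical_set_scope.
Local Open Scope ring_scope.

(** * Convex functions and the mirror step *)

(** Origin of the constants. A mirror step moves each coordinate of a policy by at most eta |A| /
    (lam (1 - gamma)), and passing to the l_1 distance costs another |A|: hence |A|^2. If the
    stationary distribution is c-Lipschitz in the policy, u drifts by 2 (1 + c) / (sigma^2 (1 -
    gamma)^3) times that distance. Here c = 2 + 2 l, where l is the ceiling plus 1 / (1 - kappa), so
    2 (1 + c) = 6 + 4 l <= 6 + 4 L. The prescribed eta makes the accumulated drift term equal to the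
    initial divergence term, hence the factor 2. In the first term of the bound, 3 = 2 + 1: a lower
    bound on Phi, and the gap of pi_0, which the drift inequality does not reach.

    Two obstacles. For m < 1 the ceiling is nonpositive, so l need not dominate a mixing time; but
    mixing at time 0 forces m >= 1/2 once there are two states, while for one state the stationary
    distribution is constant and c = 0 works. And sigma is an infimum over infinitely many policies,
    whereas ergodicity is given for each policy separately; its positivity comes from an induction
    on sets of states. *)

Section DotProduct.
Context {R : realType} {n : nat}.
Implicit Types x y z : 'rV[R]_n.

Lemma dotpDr x y z : dotp x (y + z) = dotp x y + dotp x z.
Proof. by rewrite /dotp -big_split; apply: eq_bigr => i _; rewrite mxE mulrDr. Qed.

Lemma dotpZr x (t : R) y : dotp x (t *: y) = t * dotp x y.
Proof. by rewrite /dotp mulr_sumr; apply: eq_bigr => i _; rewrite mxE mulrCA. Qed.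

Lemma dotp0r x : dotp x 0 = 0.
Proof. by rewrite -[X in dotp x X](scale0r 0) dotpZr mul0r. Qed.

Lemma dotpC x y : dotp x y = dotp y x.
Proof. by apply: eq_bigr => i _; rewrite mulrC. Qed.

Lemma dotpDl x y z : dotp (x + y) z = dotp x z + dotp y z.
Proof. by rewrite dotpC dotpDr !(dotpC z). Qed.

Lemma dotpNr x y : dotp x (- y) = - dotp x y.
Proof. by rewrite -scaleN1r dotpZr mulN1r. Qed.

Lemma dotpNl x y : dotp (- x) y = - dotp x y.
Proof. by rewrite dotpC dotpNr dotpC. Qed.

Lemma dotpBr x y z : dotp x (y - z) = dotp x y - dotp x z.
Proof. by rewrite dotpDr dotpNr. Qed.

Lemma dotpBl x y z : dotp (x - y) z = dotp x z - dotp y z.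
Proof. by rewrite dotpDl dotpNl. Qed.

Lemma dotp_delta x i : dotp x (delta_mx 0 i) = x 0 i.
Proof.
rewrite /dotp (bigD1 i) //= mxE !eqxx mulr1 big1 ?addr0 // => j ji.
by rewrite mxE (negbTE ji) andbF mulr0.
Qed.

Lemma continuous_dotp x : continuous (dotp x).
Proof.
apply: continuous_big => [|i _ y]; first exact: add_continuous.
by apply: cvgMl_tmp; [exact: nbhs_filter|exact: (@coord_continuous _ _ _ 0 i)].
Qed.

End DotProduct.

Section ConvexFunction.
Context {R : realType} {n : nat}.
Variable h : 'rV[R]_n -> \bar R.
Hypotheses (h_proper : proper_fun h) (h_convex : strictly_convex h).
Implicit Types x y p q v : 'rV[R]_n.

Local Notation H := (fine \o h).

Lemma edomE x : edom h x -> h x = (H x)%:E.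
Proof.
case: h_proper => hN _ hx; rewrite /comp /= fineK // fin_numE hN /=.
by rewrite lt_eqF.
Qed.

Lemma convex_segment q p (t : R) : edom h q -> edom h p -> 0 <= t <= 1 ->
  edom h (q + t *: (p - q)) /\ H (q + t *: (p - q)) <= H q + t * (H p - H q).
Proof.
move=> hq hp /andP[t0 t1].
have [->|tN0] := eqVneq t 0; first by rewrite scale0r addr0 mul0r addr0.
have [->|tN1] := eqVneq t 1.
  by rewrite scale1r addrC subrK mul1r addrC subrK.
have [->|pq] := eqVneq p q; first by rewrite !subrr scaler0 mulr0 !addr0.
have t01 : 0 < t < 1 by rewrite !lt_neqAle eq_sym tN0 tN1 t0 t1.
have := h_convex hp hq pq t01.
have -> : t *: p + (1 - t) *: q = q + t *: (p - q).
  by rewrite scalerBl scalerBr scale1r addrCA.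
rewrite (edomE hp) (edomE hq) -!EFinM -EFinD => lt1.
have e : edom h (q + t *: (p - q)) by apply: lt_trans lt1 _; rewrite ltry.
split=> //; move: lt1; rewrite (edomE e) lte_fin => /ltW /le_trans; apply.
rewrite [leLHS](_ : _ = H q + t * (H p - H q)) //; ring.
Qed.

(** A domain with an interior point [y0] has the whole space as affine hull: any [z] lies on the
    line through [y0] and a point [y1] of the domain close to [y0]. *)
Lemma rint_interior x : (edom h)° !=set0 -> rint (edom h) x -> (edom h)° x.
Proof.
case=> y0 /nbhs_ballP[e e0 ye] [_ [r r0 xr]].
apply/nbhs_ballP; exists r => //= z xz; apply: xr; split=> //.
have [->|zy] := eqVneq z y0.
  exists 1%N, (fun=> 1), (fun=> y0); rewrite !big_ord1 scale1r; split=> //.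
  by move=> _; apply: ye; apply: ballxx.
(* This scaling puts [y1] at distance [e / 2] from [y0]; then [z] is recovered with coefficients
   [1 - t^-1] and [t^-1]. *)
pose t : R := (e / 2) / `|z - y0|.
have nz : 0 < `|z - y0| by rewrite normr_gt0 subr_eq0.
have t0 : 0 < t by rewrite !divr_gt0.
pose y1 := y0 + t *: (z - y0).
exists 2%N, (fun i => if i == 0 then 1 - t^-1 else t^-1),
  (fun i => if i == 0 then y0 else y1); split.
- move=> i; case: ifP => _; first by apply: ye; apply: ballxx.
  apply: ye; rewrite mx_norm_ball /ball_ /= /y1 opprD addNKr normrN normrZ.
  rewrite gtr0_norm // /t divfK ?gt_eqF // ltr_pdivrMr // ltr_pMr // ltr1n //.
- by rewrite big_ord_recl big_ord1 /= subrK.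
- rewrite big_ord_recl big_ord1 /= /y1 scalerDr scalerA mulVf ?gt_eqF // scale1r.
  by rewrite scalerBl scale1r addrA subrK addrC subrK.
Qed.

Lemma interior_edom x : (edom h)° x -> edom h x.
Proof. exact: interior_subset. Qed.

(** The homothety of centre [p] and ratio [t] sends the ball of radius [e] around [q] onto the ball
    of radius [t * e] around the point, and convexity keeps the image in the domain. *)
Lemma interior_segment p q (t : R) : edom h p -> (edom h)° q -> 0 < t <= 1 ->
  (edom h)° (p + t *: (q - p)).
Proof.
move=> hp /nbhs_ballP[e e0 qe] /andP[t0 t1]; apply/nbhs_ballP.
exists (t * e); first by rewrite /= mulr_gt0.
move=> y; rewrite mx_norm_ball /ball_ /= => yx.
have -> : y = p + t *: ((q + t^-1 *: (y - (p + t *: (q - p)))) - p).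
  rewrite [q + _ - p]addrAC [t *: (_ + _)]scalerDr scalerA divff ?gt_eqF //.
  by rewrite scale1r addrA addrC subrK.
have [] // := @convex_segment p (q + t^-1 *: (y - (p + t *: (q - p)))) t hp;
  last by rewrite (ltW t0).
apply: qe; rewrite mx_norm_ball /ball_ /= opprD addNKr normrN normrZ normfV.
by rewrite distrC gtr0_norm // mulrC ltr_pdivrMr // mulrC.
Qed.

Lemma derive_dotp q v : differentiable H q -> 'D_v H q = dotp (grad h q) v.
Proof.
move=> dH; rewrite deriveE // /dotp.
rewrite {1}[v]matrix_sum_delta big_ord1 linear_sum /=; apply: eq_bigr => i _.
by rewrite linearZ /= /grad mxE deriveE // mulrC.
Qed.

Lemma directional_limit q v : differentiable H q ->
  forall e : R, 0 < e -> exists2 d : R, 0 < d & forall t, 0 < t < d ->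
    `|t^-1 * (H (q + t *: v) - H q) - dotp (grad h q) v| < e.
Proof.
move=> dH e e0; have dv : derivable H q v by apply: diff_derivable.
have /cvgrPdist_lt/(_ e e0) := dv.
rewrite -/(derive H q v) derive_dotp // near_withinE => /nbhs_ballP[d /= d0 dP].
exists d => // t /andP[t0 td].
have : `|0 - t| < d by rewrite sub0r normrN gtr0_norm.
by move=> /(dP t) /=; rewrite gt_eqF // distrC [t *: v + q]addrC; apply.
Qed.

(** The slack [t * c] vanishes as t tends to 0. It is there for strong convexity, whose factor t (1
    - t) leaves a term of order t^2. *)
Lemma grad_le q v (a c : R) : differentiable H q ->
  (forall t, 0 < t <= 1 -> H (q + t *: v) - H q <= t * (a + t * c)) ->
  dotp (grad h q) v <= a.
Proof.
move=> dH le_a; apply/ler_addgt0Pr => e e0.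
have [d d0 dP] := directional_limit v dH (divr_gt0 e0 (ltr0n R 2)).
(* With [t <= e / k], the slack is at most [e / 2]; the [+ 1] keeps [k] positive when [c] is 0. *)
pose k : R := 2 * (`|c| + 1).
have k0 : 0 < k by rewrite mulr_gt0 // ltr_wpDl.
pose t := Num.min 1 (Num.min (d / 2) (e / k)).
have t0 : 0 < t by rewrite !lt_min ltr01 !divr_gt0.
have t1 : t <= 1 by rewrite ge_min lexx.
have td : t < d.
  by rewrite !gt_min; apply/orP; right; rewrite gtr_pMr ?d0 // invf_lt1 ?ltr1n.
have te : t * c <= e / 2.
  apply: (@le_trans _ _ (t * (`|c| + 1))).
    by rewrite ler_pM2l // (le_trans (ler_norm c)) // lerDl.
  apply: (@le_trans _ _ (e / k * (`|c| + 1))).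
    by rewrite ler_pM2r ?ltr_wpDl // !ge_min lexx !orbT.
  by rewrite /k invfM mulrA mulfVK // gt_eqF // ltr_wpDl.
have := dP t; rewrite t0 td => /(_ isT); rewrite ltr_norml => /andP[lo _].
have := le_a t; rewrite t0 t1 => /(_ isT); rewrite mulrC -ler_pdivrMr // mulrC.
move: lo te; set X := t^-1 * _; set Y := dotp _ _ => *; lra.
Qed.

Lemma grad_ge q v (a : R) : differentiable H q ->
  (forall t, 0 < t <= 1 -> t * a <= H (q + t *: v) - H q) ->
  a <= dotp (grad h q) v.
Proof.
move=> dH le_a; apply/ler_addgt0Pr => e e0.
have [d d0 dP] := directional_limit v dH e0.
pose t := Num.min 1 (d / 2).
have t0 : 0 < t by rewrite !lt_min ltr01 !divr_gt0.
have t1 : t <= 1 by rewrite ge_min lexx.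
have td : t < d.
  by rewrite !gt_min; apply/orP; right; rewrite gtr_pMr ?d0 // invf_lt1 ?ltr1n.
have := dP t; rewrite t0 td => /(_ isT); rewrite ltr_norml => /andP[_ hi].
have := le_a t; rewrite t0 t1 => /(_ isT); rewrite mulrC -ler_pdivlMr // mulrC.
move: hi; set X := t^-1 * _; set Y := dotp _ _ => *; lra.
Qed.

Lemma grad_inequality p q : edom h p -> edom h q -> differentiable H q ->
  dotp (grad h q) (p - q) <= H p - H q.
Proof.
move=> hp hq dH; apply: (@grad_le _ _ _ 0) => // t /andP[t0 t1].
rewrite mulr0 addr0.
have [] := @convex_segment q p t hq hp; first by rewrite (ltW t0).
by move=> _; rewrite lerBlDl.
Qed.

Hypothesis h_smooth : essentially_smooth h.

(* If p were on the boundary, minimality bounds the gradient from below in the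
   direction q - p along the segment, and convexity together with an upper bound
   of h near q turns this into a bound of the whole gradient. *)
Lemma minimizer_interior p q v : edom h p -> (edom h)° q ->
  (forall t : R, 0 < t <= 1 ->
     H p + t * dotp v (q - p) <= H (p + t *: (q - p))) ->
  (edom h)° p.
Proof.
case: h_smooth => _ dH blowup hp hq pmin; apply: contrapT => hNp.
pose x t := p + t *: (q - p).
have hx t : 0 < t <= 1 -> (edom h)° (x t) by exact: interior_segment.
have gx t : 0 < t <= 1 -> dotp v (q - p) <= dotp (grad h (x t)) (q - p).
  move=> t01; have t0 : 0 < t by case/andP: t01.
  have := grad_inequality hp (interior_edom (hx t t01)) (dH _ (hx t t01)).
  have -> : p - x t = - (t *: (q - p)) by rewrite /x opprD addNKr.
  rewrite dotpNr dotpZr => h1; have := pmin t t01; rewrite -/(x t) => h2.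
  by rewrite -(ler_pM2l t0); lra.
have [r r0 hr] : exists2 r : R, 0 < r & forall y, `|y - q| < r ->
    edom h y /\ H y <= H q + 1.
  have cH : {for q, continuous H} by exact: differentiable_continuous (dH _ hq).
  have /cvgrPdist_lt/(_ 1 ltr01)/nbhs_ballP[r1 /= r10 r1P] := cH.
  case/nbhs_ballP: (hq) => r2 /= r20 r2P.
  exists (Num.min r1 r2); first by rewrite lt_min r10.
  move=> y; rewrite lt_min => /andP[y1 y2]; split.
    by apply: r2P; rewrite mx_norm_ball /ball_ /= distrC.
  have := r1P y; rewrite mx_norm_ball /ball_ /= distrC => /(_ y1).
  by rewrite ltr_norml => /andP[]; lra.
pose C := H q + 1 - H p - dotp v (q - p).
(* The gradient inequality at [x t] is tested at [q + z]. The part along [q - p] has weight [1 - t],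
   minimality at [x t] contributes weight [t], and together they give the constant [dotp v (q - p)]
   of [C], independent of [t]. *)
have gb t z : 0 < t <= 1 -> `|z| < r -> dotp (grad h (x t)) z <= C.
  move=> t01 zr; have [hqz Hqz] := hr (q + z) ltac:(by rewrite addrC addKr).
  have := grad_inequality hqz (interior_edom (hx t t01)) (dH _ (hx t t01)).
  have -> : q + z - x t = z + (1 - t) *: (q - p).
    by apply/rowP => i; rewrite !mxE; ring.
  rewrite dotpDr dotpZr.
  have := gx t t01; have := pmin t t01; rewrite -/(x t) /C.
  case/andP: t01 => t0 t1 h1 h2 h3.
  have : (1 - t) * dotp v (q - p) <= (1 - t) * dotp (grad h (x t)) (q - p).
    by apply: ler_wpM2l h2; rewrite subr_ge0.
  lra.
have C0 : 0 <= C.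
  by have := @gb 1 0; rewrite ltr01 lexx normr0 dotp0r => /(_ isT r0).
have gn t : 0 < t <= 1 -> `|grad h (x t)| <= C / (r / 2).
  move=> t01; rewrite [leLHS]mx_normrE; apply: bigmax_le.
    by rewrite divr_ge0 // ltW // divr_gt0.
  move=> [i0 i] _ /=; rewrite ord1 ler_pdivlMr ?divr_gt0 //.
  have r2 : `|r / 2| < r by rewrite gtr0_norm ?divr_gt0 // gtr_pMr // invf_lt1 ?ltr1n.
  have dn : `|delta_mx 0 i : 'rV[R]_n| <= 1.
    rewrite [leLHS]mx_normrE; apply: bigmax_le => // j _; rewrite mxE.
    by case: (_ && _); rewrite ?normr0 ?normr1.
  (* Testing [gb] in the directions plus and minus [r / 2] times a basis vector bounds every
     coordinate of the gradient. *)
  have zb s : `|s| = 1 -> `|(s * (r / 2)) *: delta_mx 0 i : 'rV[R]_n| < r.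
    move=> s1; rewrite normrZ normrM s1 mul1r; apply: le_lt_trans r2.
    by rewrite ler_piMr.
  rewrite -(gtr0_norm (divr_gt0 r0 (ltr0n R 2))) -normrM ler_norml.
  have := gb t _ t01 (zb 1 (normr1 R)); have := gb t _ t01 (zb (-1) (normrN1 R)).
  by rewrite !dotpZr dotp_delta => *; apply/andP; split; lra.
pose t_ k : R := k.+1%:R^-1.
have t_01 k : 0 < t_ k <= 1 by rewrite invr_gt0 ltr0n invf_le1 ?ltr0n //= ler1n.
have tx : x (t_ k) @[k --> \oo] --> p.
  rewrite -[X in _ --> X]addr0 -(scale0r (q - p)) /x.
  by apply: cvgD; [exact: cvg_cst|apply: cvgZr_tmp; exact: cvg_harmonic].
have := blowup (fun k => x (t_ k)) p (fun k => hx _ (t_01 k)) tx hNp.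
move=> /cvgryPgt/(_ (C / (r / 2))) [N _ /(_ N (leqnn N)) /=].
by rewrite ltNge gn.
Qed.

End ConvexFunction.

(** Without a minimum, the open sets where f exceeds one of its values on [C] would cover [C]; the
    least value in a finite subcover is then attained at a point of [C] that no member covers. *)
Lemma lsc_compact_min (R : realType) (T : ptopologicalType) (f : T -> \bar R)
    (C : set T) : lower_semicontinuous f -> (forall x, f x != -oo%E) ->
  compact C -> C !=set0 -> exists2 x, C x & forall y, C y -> (f x <= f y)%E.
Proof.
move=> /lower_semicontinuousP fl fN cC [x0 Cx0]; apply: contrapT => Nmin.
have lt_ex x : C x -> exists2 y, C y & (f y < f x)%E.
  move=> Cx; apply: contrapT => Ny; apply: Nmin; exists x => // y Cy.
  by rewrite leNgt; apply/negP => yx; apply: Ny; exists y.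
have Uo y : C y -> open [set x | (f y < f x)%E].
  move=> _; move: (fN y); case: (f y) => [r||] // _.
  by rewrite (_ : mkset _ = set0); [exact: open0|
    rewrite -subset0 => x /=; rewrite ltNge leey].
move: cC; rewrite compact_cover => /(_ T C (fun y => [set x | (f y < f x)%E]) Uo).
case=> [x /lt_ex[y Cy yx]|D DC Cs]; first by exists y.
have [x xD _] := Cs x0 Cx0.
pose z := [arg min_(y < [` xD]%fset) f (val y)]%O.
have zmin y : y \in D -> (f (val z) <= f y)%E.
  by move=> yD; rewrite /z; case: arg_minP => // u _ /(_ [` yD]%fset isT).
have Cz : C (val z) by exact: set_mem (DC _ (valP z)).
have [y yD /=] := Cs _ Cz.
by rewrite ltNge zmin.
Qed.

(** * Compactness of the probability simplex *)

Section Simplex.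
Context {R : realType} {A : finType}.
Implicit Types p q : fdist R A.

Lemma fdist_ext p q : (forall a, p a = q a) -> p = q.
Proof.
case: p q => [f f0 f1] [g g0 g1] /= fg.
have E : f = g by exact/funext.
by subst g; congr FDist; exact: Prop_irrelevance.
Qed.

Lemma fdist_le1 p a : p a <= 1.
Proof.
by rewrite -(fdist_sum1 p) (bigD1 a) //= lerDl sumr_ge0 // => i _; exact: fdist_ge0.
Qed.

Lemma sum_enum_val (F : A -> R) : \sum_(i < #|A|) F (enum_val i) = \sum_a F a.
Proof. by rewrite (reindex _ (onW_bij _ (enum_val_bij A))). Qed.

Lemma dotp_vec (f g : A -> R) : dotp (vec f) (vec g) = \sum_a f a * g a.
Proof.
by rewrite /dotp -sum_enum_val; apply: eq_bigr => i _; rewrite !mxE.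
Qed.

Lemma vec_segment p q (t : R) : 0 <= t <= 1 ->
  exists r : fdist R A, vec r = vec p + t *: (vec q - vec p).
Proof.
move=> /andP[t0 t1].
have ge0 a : 0 <= p a + t * (q a - p a).
  have := fdist_ge0 p a; have := fdist_ge0 q a => q0 p0.
  by rewrite mulrBr addrCA -[X in X - _]mul1r -mulrBl addr_ge0 ?mulr_ge0 ?subr_ge0.
have s1 : \sum_a (p a + t * (q a - p a)) = 1.
  by rewrite big_split /= -mulr_sumr sumrB !fdist_sum1 subrr mulr0 addr0.
by exists (FDist ge0 s1); apply/rowP => i; rewrite !mxE.
Qed.

Definition simplex : set 'rV[R]_#|A| := [set vec p | p in [set: fdist R A]].

Lemma simplexE : simplex =
  [set x | \sum_i x 0 i = 1] `&` \bigcap_(i in [set: 'I_#|A|]) [set x | 0 <= x 0 i].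
Proof.
apply/seteqP; split=> [_ [p _ <-]|x /= [x1 x0]].
  split=> [|i _] /=; last by rewrite mxE fdist_ge0.
  by under eq_bigr do rewrite mxE; rewrite sum_enum_val fdist_sum1.
have ge0 a : 0 <= x 0 (enum_rank a) by exact: x0.
have s1 : \sum_a x 0 (enum_rank a) = 1.
  by rewrite -x1 -sum_enum_val; apply: eq_bigr => i _; rewrite enum_valK.
by exists (FDist ge0 s1) => //; apply/rowP => i; rewrite mxE /= enum_valK.
Qed.

Lemma compact_simplex : compact simplex.
Proof.
apply: bounded_closed_compact.
  exists 1; split=> [|M M1 _ [p _ <-]]; first exact: real1.
  rewrite /= [leLHS]mx_normrE; apply: bigmax_le => [|i _].
    by rewrite ltW // (lt_trans ltr01).
  by rewrite mxE ger0_norm ?fdist_ge0 // (le_trans (fdist_le1 _ _)) // ltW.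
rewrite simplexE; apply: closedI.
  apply: (@closed_comp _ _ (fun x : 'rV[R]_#|A| => \sum_i x 0 i) [set 1]).
    move=> x _; move: x; apply: continuous_big => [|i _]; first exact: add_continuous.
    exact: (@coord_continuous _ _ _ 0 i).
  exact: closed_eq.
apply: closed_bigI => i _.
apply: (@closed_comp _ _ (fun x : 'rV[R]_#|A| => x 0 i) [set y | 0 <= y]).
  by move=> x _; exact: (@coord_continuous _ _ _ 0 i).
exact: closed_ge.
Qed.

End Simplex.

Lemma lsc_sub_linear (R : realType) (n : nat) (h : 'rV[R]_n -> \bar R) v :
  lower_semicontinuous h ->
  lower_semicontinuous (fun x => h x - (dotp v x)%:E)%E.
Proof.
move=> lh x a ax0.
have {ax0}ax : ((a + dotp v x)%:E < h x)%E by rewrite EFinD -lteBrDr.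
have [b ab bx] : exists2 b : R, a + dotp v x < b & (b%:E < h x)%E.
  case: (h x) ax => [r|_|//].
    rewrite lte_fin => ar; exists ((a + dotp v x + r) / 2); first by rewrite midf_lt.
    by rewrite lte_fin midf_lt.
  by exists (a + dotp v x + 1); rewrite ?ltrDl // ltry.
have [V xV hV] := lh x b bx.
exists (V `&` [set y | dotp v y < b - a]).
  apply: filterI => //.
  have /cvgr_lt : dotp v y @[y --> x] --> dotp v x by exact: continuous_dotp.
  by apply; rewrite ltrBrDl.
move=> y [/hV by_ /= vy].
suff : ((a + dotp v y)%:E < h y)%E by rewrite EFinD -lteBrDr.
by apply: lt_trans by_; rewrite lte_fin addrC -ltrBrDr.
Qed.

(** Strong convexity enters the proof only through single coordinates, which makes the argument
    uniform in the exponent. *)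
Lemma coord_le_lp_norm (R : realType) (n : nat) (p : \bar R) (x : 'rV[R]_n) i :
  (1 <= p)%E -> `|x 0 i| <= lp_norm p x.
Proof.
case: p => [r| |] //= r1; last by apply: (le_bigmax _ (fun i => `|x 0 i|)).
have r0 : 0 < r by rewrite (lt_le_trans ltr01) // -lee_fin.
have -> : `|x 0 i| = (`|x 0 i| `^ r) `^ r^-1.
  by rewrite -powRrM divff ?gt_eqF // powRr1.
apply: ge0_ler_powR; rewrite ?nnegrE ?invr_ge0 ?powR_ge0 ?(ltW r0) //.
  by apply: sumr_ge0 => j _; exact: powR_ge0.
by rewrite (bigD1 i) //= lerDl; apply: sumr_ge0 => j _; exact: powR_ge0.
Qed.

(** * One mirror descent step on the simplex *)

Section MirrorStep.
Context {R : realType} {A : finType}.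
Variable h : 'rV[R]_#|A| -> \bar R.
Implicit Types p q r : fdist R A.

Local Notation H := (fine \o h).

(** Real-valued so that it can be added and averaged freely; it agrees with [bregman] when both
    points are in [edom h], since [fine] collapses infinite values to 0. *)
Definition real_bregman (x y : 'rV[R]_#|A|) : R :=
  H x - H y - dotp (grad h y) (x - y).

Local Notation D := real_bregman.

Hypothesis h_mirror : mirror_map h.

Let h_proper : proper_fun h. Proof. by case: h_mirror. Qed.
Let h_lsc : lower_semicontinuous h. Proof. by case: h_mirror. Qed.
Let h_convex : strictly_convex h. Proof. by case: h_mirror. Qed.
Let h_smooth : essentially_smooth h. Proof. by case: h_mirror. Qed.

Lemma mirror_differentiable x : (edom h)° x -> differentiable H x.
Proof. by case: h_smooth => _ dH _; exact: dH. Qed.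

Lemma mirror_rint x : rint (edom h) x -> (edom h)° x.
Proof. by apply: rint_interior; case: h_smooth. Qed.

Lemma bregmanE x y : edom h x -> edom h y -> bregman h x y = (D x y)%:E.
Proof. by move=> hx hy; rewrite /bregman (edomE h_proper hx) (edomE h_proper hy). Qed.

Lemma bregman_three_point x y z :
  D x z = D x y + D y z + dotp (grad h y - grad h z) (x - y).
Proof. by rewrite /D !dotpBr !dotpBl; ring. Qed.

Lemma bregman_lty x y : edom h y -> (bregman h x y < +oo)%E -> edom h x.
Proof.
move=> hy; rewrite /bregman /edom /= (edomE h_proper hy).
by case: h_proper => /(_ x) + _; case: (h x) => // r _ _; rewrite ltry.
Qed.

Lemma bregman_interior_ge0 x y : edom h x -> (edom h)° y -> 0 <= D x y.
Proof.
move=> hx hy; rewrite /D subr_ge0.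
by apply: grad_inequality => //; [exact: interior_edom|exact: mirror_differentiable].
Qed.

(** Strong convexity on the segment from q to p, divided by t, becomes a bound on the directional
    derivative at q as t tends to 0. *)
Lemma strong_convexity_bregman (lam : R) (e : \bar R) p q : 0 <= lam -> (1 <= e)%E ->
  strongly_convex_simplex h lam e -> edom h (vec p) -> (edom h)° (vec q) ->
  forall a, lam / 2 * (p a - q a) ^+ 2 <= D (vec p) (vec q).
Proof.
move=> lam0 e1 strong hp hq a.
have hq' := interior_edom hq.
set N := lp_norm e (vec p - vec q).
have aN : (p a - q a) ^+ 2 <= N ^+ 2.
  rewrite -[leLHS]real_normK ?num_real // lerXn2r ?nnegrE //.
    by rewrite (le_trans _ (coord_le_lp_norm _ (enum_rank a) e1)).
  by have := coord_le_lp_norm (vec p - vec q) (enum_rank a) e1; rewrite !mxE enum_rankK.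
apply: (@le_trans _ _ (lam / 2 * N ^+ 2)).
  by apply: ler_wpM2l => //; rewrite divr_ge0.
rewrite /D lerBrDr -lerBrDl.
apply: (@grad_le _ _ _ _ _ _ (lam / 2 * N ^+ 2)); first exact: mirror_differentiable.
move=> t /andP[t0 t1].
have t01 : 0 <= t <= 1 by rewrite (ltW t0).
have := strong p q t t01.
have [ht _] := convex_segment h_proper h_convex hq' hp t01.
have -> : t *: vec p + (1 - t) *: vec q = vec q + t *: (vec p - vec q).
  by apply/rowP => i; rewrite !mxE; ring.
rewrite (edomE h_proper hp) (edomE h_proper hq') (edomE h_proper ht).
rewrite -!EFinM -!EFinD lee_fin -/N; lra.
Qed.

Lemma pmd_update_maximal (S : finType) (eta : R) (Q : S -> A -> R)
    (pi : policy R S A) s r : (edom h)° (vec (pi s)) ->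
  (pmd_objective h eta Q pi s r
     <= pmd_objective h eta Q pi s (pmd_update h eta Q pi s))%E.
Proof.
move=> hq; have hq' := interior_edom hq; rewrite /pmd_update.
suff ex : exists p, [set p | forall r, (pmd_objective h eta Q pi s r
     <= pmd_objective h eta Q pi s p)%E] p.
  by case: ex => p0 P0; exact: (xgetPex (pi s) (ex_intro _ p0 P0)).
set q := vec (pi s).
pose v := eta *: vec (Q s) + grad h q.
have objE p : (pmd_objective h eta Q pi s p =
    (H q - dotp (grad h q) q)%:E - (h (vec p) - (dotp v (vec p))%:E))%E.
  rewrite /pmd_objective /bregman (edomE h_proper hq').
  have -> : eta * \sum_a p a * Q s a = dotp (eta *: vec (Q s)) (vec p).
    by rewrite dotpC dotpZr dotp_vec.
  case: h_proper => /(_ (vec p)) + _.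
  case: (h (vec p)) => [x||] //= _; rewrite -/q.
  rewrite -!EFinB; congr EFin; rewrite /v dotpDl dotpBr /=; ring.
have [_ [p _ <-] pmin] := lsc_compact_min (lsc_sub_linear (v := v) h_lsc)
  (fun x => ltac:(case: h_proper => /(_ x); by case: (h x))) (@compact_simplex R A)
  (ex_intro _ q (ex_intro2 _ _ (pi s) I erefl)).
exists p => r' /=; rewrite !objE leeB // pmin //; by exists r'.
Qed.

Section PmdUpdate.
Context {S : finType}.
Variables (eta : R) (Q : S -> A -> R) (pi : policy R S A) (s : S).
Hypothesis pi_int : (edom h)° (vec (pi s)).

Local Notation q := (vec (pi s)).
Local Notation q' := (vec (pmd_update h eta Q pi s)).

Lemma pmd_update_edom : edom h q'.
Proof.
have := pmd_update_maximal eta Q (pi s) pi_int.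
have hq := interior_edom pi_int.
rewrite /pmd_objective (bregmanE hq hq) -EFinB.
rewrite /bregman (edomE h_proper hq) /edom /=.
case: h_proper => /(_ q') + _.
by case: (h q') => // r _ _; rewrite ltry.
Qed.

Lemma pmd_update_min p : edom h (vec p) ->
  H q' - dotp (eta *: vec (Q s) + grad h q) q'
    <= H (vec p) - dotp (eta *: vec (Q s) + grad h q) (vec p).
Proof.
move=> hp; have := pmd_update_maximal eta Q p pi_int.
have hq := interior_edom pi_int.
rewrite /pmd_objective (bregmanE hp hq) (bregmanE pmd_update_edom hq) -!EFinB lee_fin.
have E r : eta * \sum_a r a * Q s a = dotp (eta *: vec (Q s)) (vec r).
  by rewrite dotpC dotpZr dotp_vec.
rewrite !E /D !dotpDl !dotpBr; lra.
Qed.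

(** This is what lets the algorithm be iterated, the next divergence using the gradient at [q'].
    Minimality is needed only on the segment from [q'] to the current policy, which stays in the
    simplex. *)
Lemma pmd_update_interior : (edom h)° q'.
Proof.
have hq' := pmd_update_edom.
apply: (minimizer_interior h_proper h_convex h_smooth
  (v := eta *: vec (Q s) + grad h q) hq' pi_int).
move=> t /andP[t0 t1].
have [r rE] := @vec_segment R A (pmd_update h eta Q pi s) (pi s) t
  ltac:(by rewrite (ltW t0)).
have hr : edom h (vec r).
  rewrite rE; apply: (proj1 (convex_segment h_proper h_convex hq' _ _)).
    exact: interior_edom.
  by rewrite (ltW t0).
have := pmd_update_min hr; rewrite rE dotpDr dotpZr; lra.
Qed.

(** The first-order optimality condition [gv] is obtained along segments of the simplex starting at
    [q'], and inserted into the three-point identity for Bregman divergences. *)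
Lemma pmd_update_three_point p : edom h (vec p) ->
  eta * \sum_a (p a - pmd_update h eta Q pi s a) * Q s a
    <= D (vec p) q - D (vec p) q' - D q' q.
Proof.
move=> hp; set v := eta *: vec (Q s) + grad h q.
have hq' := pmd_update_edom.
have gv : dotp v (vec p - q') <= dotp (grad h q') (vec p - q').
  apply: grad_ge; first exact: mirror_differentiable pmd_update_interior.
  move=> t /andP[t0 t1].
  have [r rE] := @vec_segment R A (pmd_update h eta Q pi s) p t
    ltac:(by rewrite (ltW t0)).
  have hr : edom h (vec r).
    rewrite rE; apply: (proj1 (convex_segment h_proper h_convex hq' _ _)) => //.
    by rewrite (ltW t0).
  have := pmd_update_min hr; rewrite rE -/v dotpDr dotpZr; lra.
rewrite (bregman_three_point (vec p) q' q).
have -> : eta * \sum_a (p a - pmd_update h eta Q pi s a) * Q s a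
    = dotp (eta *: vec (Q s)) (vec p - q').
  rewrite dotpC dotpZr -dotp_vec; congr (_ * dotp _ _).
  by apply/rowP => i; rewrite !mxE.
by rewrite dotpBl; move: gv; rewrite /v dotpDl; lra.
Qed.

(** Comparing the update with the current policy itself bounds the sum of the two opposite
    divergences by eta times a linear term. Strong convexity makes the left side quadratic in the
    largest coordinate change, so that change is of order eta. *)
Lemma pmd_update_drift (lam : R) (e : \bar R) (b : R) : 0 < lam -> (1 <= e)%E ->
    strongly_convex_simplex h lam e -> 0 <= eta -> (forall a, `|Q s a| <= b) ->
  forall a, `|pmd_update h eta Q pi s a - pi s a| <= eta * b * #|A|%:R / lam.
Proof.
move=> lam0 e1 strong eta0 Qb a0.
pose d a := `|pmd_update h eta Q pi s a - pi s a|.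
rewrite -/(d a0); case: (arg_maxP d (erefl : xpredT a0)) => a _ amax0.
have {}amax a' : d a' <= d a by exact: amax0.
apply: le_trans (amax a0) _.
have hq := interior_edom pi_int.
have st1 := strong_convexity_bregman (ltW lam0) e1 strong hq pmd_update_interior a.
have st2 := strong_convexity_bregman (ltW lam0) e1 strong pmd_update_edom pi_int a.
have D0 : D q q = 0 by rewrite /D !subrr dotp0r subr0.
have := pmd_update_three_point hq; rewrite D0.
have sumQ : - (b * #|A|%:R * d a)
    <= \sum_a (pi s a - pmd_update h eta Q pi s a) * Q s a.
  rewrite lerNl -sumrN -mulrA [#|A|%:R * _]mulr_natl mulrnAr.
  rewrite -sumr_const; apply: ler_sum => a' _.
  rewrite -mulNr opprB (le_trans (ler_norm _)) // normrM mulrC.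
  by apply: ler_pM => //; exact: amax.
have E : (pmd_update h eta Q pi s a - pi s a) ^+ 2 = d a ^+ 2.
  by rewrite /d real_normK ?num_real.
have {}st1 : lam / 2 * d a ^+ 2 <= D q q' by rewrite -E -sqrrN opprB.
have {}st2 : lam / 2 * d a ^+ 2 <= D q' q by rewrite -E.
move=> tp; have {}tp : lam * d a ^+ 2 <= eta * (b * #|A|%:R * d a).
  by have := ler_wpM2l eta0 sumQ; lra.
have [->|da] := eqVneq (d a) 0.
  rewrite divr_ge0 ?(ltW lam0) // !mulr_ge0 //.
  exact: le_trans (normr_ge0 _) (Qb a).
have dpos : 0 < d a by rewrite lt_neqAle eq_sym da normr_ge0.
by rewrite ler_pdivlMr // -(ler_pM2r dpos); lra.
Qed.

End PmdUpdate.

End MirrorStep.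

(** * Discounted resolvents and perturbation of stationary distributions *)

Definition stochastic (R : realType) (T : finType) (K : T -> T -> R) : Prop :=
  (forall x y, 0 <= K x y) /\ (forall x, \sum_y K x y = 1).

Section Resolvent.
Context {R : realType} {T : finType}.
Variable g : R.
Hypotheses (g0 : 0 <= g) (g1 : g < 1).
Implicit Types (K : T -> T -> R) (f v w : T -> R).

Lemma sum_kernel K f : stochastic K ->
  \sum_y \sum_x f x * K x y = \sum_x f x.
Proof.
move=> [_ K1]; rewrite exchange_big /=; apply: eq_bigr => x _.
by rewrite -mulr_sumr K1 mulr1.
Qed.

Lemma discounted_sub K f b : stochastic K ->
  (forall y, f y <= b y + g * \sum_x f x * K x y) ->
  \sum_x f x <= (\sum_x b x) / (1 - g).
Proof.
move=> hK fb; rewrite ler_pdivlMr ?subr_gt0 //.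
have : \sum_y f y <= \sum_y (b y + g * \sum_x f x * K x y) by exact: ler_sum.
by rewrite big_split -mulr_sumr sum_kernel //=; lra.
Qed.

(** The negative part of [v] satisfies the discounted inequality with zero source, so its total mass
    is 0. *)
Lemma discounted_ge0 K v w : stochastic K -> (forall y, 0 <= w y) ->
  (forall y, v y = w y + g * \sum_x v x * K x y) -> forall y, 0 <= v y.
Proof.
move=> hK w0 vE y; pose f x := Num.max (- v x) 0.
have f0 x : 0 <= f x by rewrite le_max lexx orbT.
have K0 : forall x y, 0 <= K x y by case: hK.
have : \sum_x f x <= (\sum_(x : T) 0) / (1 - g).
  apply: (@discounted_sub K) => // x; rewrite add0r ge_max; apply/andP; split; last first.
    by rewrite mulr_ge0 // sumr_ge0 // => z _; rewrite mulr_ge0.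
  rewrite lerNl vE; apply: (@le_trans _ _ (g * \sum_z v z * K z x)); last by rewrite lerDr.
  rewrite -mulrN ler_wpM2l // -sumrN ler_sum // => z _.
  by rewrite -mulNr ler_wpM2r // lerNl le_max lexx.
rewrite big1_eq mul0r => sf.
have /eqP : \sum_x f x = 0 by apply/le_anti; rewrite sf sumr_ge0.
rewrite psumr_eq0 // => /allP/(_ y); rewrite mem_index_enum => /(_ isT)/eqP fy.
by rewrite -oppr_le0 -fy /f le_max lexx.
Qed.

(** The matrix of I - g K has trivial left kernel: the absolute value of a kernel vector satisfies
    the discounted inequality with zero source. *)
Lemma discounted_exists K w : stochastic K ->
  exists v, forall y, v y = w y + g * \sum_x v x * K x y.
Proof.
move=> hK; have K0 : forall x y, 0 <= K x y by case: hK.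
pose P : 'M[R]_#|T| := \matrix_(i, j) ((i == j)%:R - g * K (enum_val i) (enum_val j)).
have sumE (F : T -> R) : \sum_(i < #|T|) F (enum_val i) = \sum_x F x.
  by rewrite (reindex _ (onW_bij _ (enum_val_bij T))).
have PE (u : 'rV_#|T|) y : (u *m P) 0 (enum_rank y) =
    u 0 (enum_rank y) - g * \sum_x u 0 (enum_rank x) * K x y.
  rewrite mxE mulr_sumr -sumE.
  have -> : u 0 (enum_rank y) = \sum_i u 0 i * (i == enum_rank y)%:R.
    rewrite (bigD1 (enum_rank y)) //= eqxx mulr1 big1 ?addr0 // => i ne.
    by rewrite (negbTE ne) mulr0.
  rewrite -sumrB; apply: eq_bigr => i _.
  by rewrite mxE enum_valK enum_rankK mulrBr; congr (_ - _); rewrite mulrCA.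
have Pu : P \in unitmx.
  rewrite -row_free_unit; apply: inj_row_free => u uP.
  have uE y : u 0 (enum_rank y) = g * \sum_x u 0 (enum_rank x) * K x y.
    by apply/eqP; rewrite -subr_eq0 -PE uP mxE.
  have : \sum_x `|u 0 (enum_rank x)| <= (\sum_(x : T) 0) / (1 - g).
    apply: (@discounted_sub K) => // y; rewrite add0r {1}uE normrM ger0_norm //.
    rewrite ler_wpM2l // (le_trans (ler_norm_sum _ _ _)) // ler_sum // => x _.
    by rewrite normrM (ger0_norm (K0 _ _)).
  rewrite big1_eq mul0r => sf; apply/rowP => i; rewrite mxE -(enum_valK i).
  have /eqP : \sum_x `|u 0 (enum_rank x)| = 0 by apply/le_anti; rewrite sf sumr_ge0.
  rewrite psumr_eq0 // => /allP/(_ (enum_val i)).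
  by rewrite mem_index_enum => /(_ isT)/eqP/normr0_eq0.
pose u := (\row_i w (enum_val i)) *m invmx P.
exists (fun x => u 0 (enum_rank x)) => y.
have := PE u y; rewrite /u mulmxKV // mxE enum_rankK => ->.
by rewrite subrK.
Qed.

Lemma discounted_norm K v w : stochastic K ->
  (forall y, v y = w y + g * \sum_x v x * K x y) ->
  \sum_x `|v x| <= (\sum_x `|w x|) / (1 - g).
Proof.
move=> hK vE; apply: (@discounted_sub K) => // y.
rewrite {1}vE (le_trans (ler_normD _ _)) // lerD2l normrM (ger0_norm g0).
rewrite ler_wpM2l // (le_trans (ler_norm_sum _ _ _)) // ler_sum // => x _.
by rewrite normrM; case: hK => K0 _; rewrite (ger0_norm (K0 _ _)).
Qed.

Lemma discounted_mass K v w : stochastic K ->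
  (forall y, v y = w y + g * \sum_x v x * K x y) ->
  \sum_x v x = (\sum_x w x) / (1 - g).
Proof.
move=> hK vE; have g1' : 1 - g != 0 by rewrite subr_eq0 eq_sym lt_eqF.
apply: (mulIf g1'); rewrite divfK // mulrBr mulr1 [_ * g]mulrC.
rewrite -{2}(sum_kernel v hK) mulr_sumr -sumrB.
by apply: eq_bigr => y _; rewrite {1}vE addrK.
Qed.

(** Transposition of I - g K. It is applied with [phi] a difference of value functions, then with
    [phi] the error of an action-value estimate. *)
Lemma discounted_dual K v w (phi : T -> R) :
  (forall y, v y = w y + g * \sum_x v x * K x y) ->
  \sum_y w y * phi y = \sum_x v x * (phi x - g * \sum_y K x y * phi y).
Proof.
move=> vE; under [RHS]eq_bigr do rewrite mulrBr; rewrite sumrB.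
have -> : \sum_x v x * (g * \sum_y K x y * phi y)
    = \sum_y (g * \sum_x v x * K x y) * phi y.
  under eq_bigr do rewrite mulrCA mulr_sumr mulr_sumr.
  rewrite exchange_big /=; apply: eq_bigr => y _.
  rewrite mulr_sumr mulr_suml; apply: eq_bigr => x _; ring.
rewrite -sumrB; apply: eq_bigr => y _; rewrite -mulrBl; congr (_ * _).
by rewrite {1}vE addrK.
Qed.

(** The difference [v' - v] solves the equation of [K'] whose source [b] collects the change of [w]
    and the change of kernel applied to [v]. *)
Lemma discounted_perturbation K K' v v' w w' (z : R) :
  stochastic K' ->
  (forall y, v y = w y + g * \sum_x v x * K x y) ->
  (forall y, v' y = w' y + g * \sum_x v' x * K' x y) ->
  (forall x, \sum_y `|K' x y - K x y| <= z) ->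
  \sum_x `|v' x - v x|
    <= (\sum_x `|w' x - w x| + g * (\sum_x `|v x|) * z) / (1 - g).
Proof.
move=> hK vE v'E hz.
pose b y := w' y - w y + g * \sum_x v x * (K' x y - K x y).
have dE y : v' y - v y = b y + g * \sum_x (v' x - v x) * K' x y.
  rewrite /b {1}v'E {1}vE.
  have -> : \sum_x v x * (K' x y - K x y)
      = \sum_x v x * K' x y - \sum_x v x * K x y.
    by rewrite -sumrB; apply: eq_bigr => x _; rewrite mulrBr.
  have -> : \sum_x (v' x - v x) * K' x y
      = \sum_x v' x * K' x y - \sum_x v x * K' x y.
    by rewrite -sumrB; apply: eq_bigr => x _; rewrite mulrBl.
  ring.
apply: le_trans (discounted_norm hK dE) _.
rewrite ler_pM2r ?invr_gt0 ?subr_gt0 //.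
apply: (@le_trans _ _ (\sum_y (`|w' y - w y|
    + g * \sum_x `|v x| * `|K' x y - K x y|))).
  apply: ler_sum => y _; rewrite (le_trans (ler_normD _ _)) // lerD2l normrM.
  rewrite (ger0_norm g0) ler_wpM2l // (le_trans (ler_norm_sum _ _ _)) //.
  by apply: ler_sum => x _; rewrite normrM.
rewrite big_split /= lerD2l -mulr_sumr -mulrA ler_wpM2l // exchange_big /=.
rewrite mulr_suml; apply: ler_sum => x _.
by rewrite -mulr_sumr ler_wpM2l.
Qed.

End Resolvent.

(** The differences sum to zero, so the other coordinates carry at least the same absolute mass,
    which compensates the factor 1/2. *)
Lemma tv_dist_coord (R : realType) (T : finType) (p q : T -> R) x :
  \sum_y p y = \sum_y q y -> `|p x - q x| <= tv_dist p q.
Proof.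
move=> pq; rewrite /tv_dist (bigD1 x) //=.
have : p x - q x = - \sum_(y | y != x) (p y - q y).
  have : \sum_y (p y - q y) = 0 by rewrite sumrB pq subrr.
  by rewrite (bigD1 x) //= => /eqP; rewrite addr_eq0 => /eqP.
move=> E; have : `|p x - q x| <= \sum_(y | y != x) `|p y - q y|.
  by rewrite E normrN ler_norm_sum.
lra.
Qed.

Section StationaryPerturbation.
Context {R : realType} {T : finType}.
Implicit Types (K : T -> T -> R) (nu : fdist R T).

Lemma stochastic_kcomp K K' : stochastic K -> stochastic K' ->
  stochastic (Defs.kcomp K K').
Proof.
move=> [K0 K1] [K0' K1']; split=> [x y|x].
  by apply: sumr_ge0 => u _; rewrite mulr_ge0.
rewrite exchange_big /= -[RHS](K1 x); apply: eq_bigr => u _.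
by rewrite -mulr_sumr K1' mulr1.
Qed.

Lemma stochastic_kpow K t : stochastic K -> stochastic (kpow K t).
Proof.
move=> hK; elim: t => [|t IH] /=; last exact: stochastic_kcomp.
split=> [x y|x]; first by rewrite ler0n.
rewrite (bigD1 x) //= eqxx big1 ?addr0 // => y /negbTE.
by rewrite eq_sym => ->.
Qed.

Lemma stochastic_le1 K x y : stochastic K -> K x y <= 1.
Proof.
by move=> [K0 K1]; rewrite -(K1 x) (bigD1 y) //= lerDl sumr_ge0.
Qed.

(** The sequence [a t], the mass at s' of nu' pushed t times through K, runs from nu' s' to nu s'.
    Each increment is the defect [e] = nu' - nu' K pushed t times through K. As [e] has total mass
    0, nu s' may be subtracted from the entries of K^t, which brings in the mixing bound; the
    increments are then summed. *)
Lemma stationary_perturbation K K' nu nu' (m kappa z c : R) :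
  stochastic K -> stationary K' nu' -> 0 < kappa < 1 -> 0 <= z ->
  (forall s t, tv_dist nu (kpow K t s) <= m * kappa ^+ t) ->
  (forall s, \sum_s' `|K' s s' - K s s'| <= z) ->
  (forall n, \sum_(t < n) Num.min 1 (m * kappa ^+ t) <= c) ->
  forall s, `|nu' s - nu s| <= z * c.
Proof.
move=> hK st' /andP[k0 k1] z0 mix hz hc s'.
have mixc s t : `|kpow K t s s' - nu s'| <= m * kappa ^+ t.
  apply: le_trans (mix s t); rewrite distrC; apply: tv_dist_coord.
  by rewrite fdist_sum1; case: (stochastic_kpow t hK).
pose a t := \sum_s nu' s * kpow K t s s'.
pose e s := nu' s - \sum_u nu' u * K u s.
have eE s : e s = \sum_u nu' u * (K' u s - K u s).
  by rewrite /e -{1}(st' s) -sumrB; apply: eq_bigr => u _; rewrite mulrBr.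
have e_sum : \sum_s e s = 0.
  by rewrite sumrB sum_kernel // subrr.
have e_norm : \sum_s `|e s| <= z.
  apply: (@le_trans _ _ (\sum_s \sum_u nu' u * `|K' u s - K u s|)).
    apply: ler_sum => s _; rewrite eE (le_trans (ler_norm_sum _ _ _)) //.
    by apply: ler_sum => u _; rewrite normrM (ger0_norm (fdist_ge0 _ _)).
  rewrite exchange_big /= -[leRHS]mul1r -(fdist_sum1 nu') mulr_suml.
  by apply: ler_sum => u _; rewrite -mulr_sumr ler_wpM2l // fdist_ge0.
have a_step t : `|a t - a t.+1| <= z * Num.min 1 (m * kappa ^+ t).
  have -> : a t - a t.+1 = \sum_s e s * (kpow K t s s' - nu s').
    under [RHS]eq_bigr do rewrite mulrBr.
    rewrite sumrB -[X in _ = _ - X]mulr_suml e_sum mul0r subr0.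
    under [RHS]eq_bigr do rewrite mulrBl.
    rewrite sumrB; congr (_ - _); rewrite /a /= /Defs.kcomp.
    under eq_bigr do rewrite mulr_sumr.
    rewrite exchange_big /=; apply: eq_bigr => s _.
    by rewrite mulr_suml; apply: eq_bigr => u _; rewrite mulrA.
  apply: (@le_trans _ _ ((\sum_s `|e s|) * Num.min 1 (m * kappa ^+ t))).
    rewrite (le_trans (ler_norm_sum _ _ _)) // mulr_suml ler_sum // => s _.
    rewrite normrM ler_wpM2l // le_min mixc andbT.
    have := stochastic_le1 s s' (stochastic_kpow t hK).
    have [/(_ s s') + _] := stochastic_kpow t hK.
    have := fdist_ge0 nu s'; have := fdist_le1 nu s'.
    by rewrite ler_norml => *; apply/andP; split; lra.
  rewrite ler_wpM2r // le_min ler01.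
  by apply: le_trans (mix s' t); rewrite /tv_dist mulr_ge0 // sumr_ge0.
have a_0 : a 0%N = nu' s'.
  rewrite /a (bigD1 s') //= eqxx mulr1 big1 ?addr0 // => s /negbTE ->.
  by rewrite mulr0.
have a_n n : `|nu' s' - a n| <= z * c.
  apply: (@le_trans _ _ (z * \sum_(t < n) Num.min 1 (m * kappa ^+ t))); last first.
    exact: ler_wpM2l.
  rewrite -a_0; elim: n => [|n IH]; first by rewrite subrr normr0 big_ord0 mulr0.
  rewrite big_ord_recr /= mulrDr (_ : a 0%N - _ = (a 0%N - a n) + (a n - a n.+1)).
    by rewrite (le_trans (ler_normD _ _)) // lerD.
  by rewrite addrA subrK.
have a_lim n : `|a n - nu s'| <= m * kappa ^+ n.
  have -> : a n - nu s' = \sum_s nu' s * (kpow K n s s' - nu s').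
    under [RHS]eq_bigr do rewrite mulrBr.
    by rewrite sumrB -[X in _ = _ - X]mulr_suml fdist_sum1 mul1r.
  rewrite (le_trans (ler_norm_sum _ _ _)) // -[leRHS]mul1r -(fdist_sum1 nu').
  rewrite mulr_suml ler_sum // => s _.
  by rewrite normrM (ger0_norm (fdist_ge0 _ _)) ler_wpM2l // fdist_ge0.
apply/ler_addgt0Pr => eps eps0.
have : m * kappa ^+ n @[n --> \oo] --> m * 0.
  by apply: cvgMl_tmp; apply: cvg_expr; rewrite gtr0_norm.
rewrite mulr0 => /cvgrPdist_lt/(_ eps eps0)[n _ /(_ n (leqnn n))] /=.
rewrite sub0r normrN => /(le_lt_trans (ler_norm _)) mn.
rewrite (_ : nu' s' - nu s' = (nu' s' - a n) + (a n - nu s')); last first.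
  by rewrite addrA subrK.
rewrite (le_trans (ler_normD _ _)) // lerD //.
exact: le_trans (a_lim n) (ltW mn).
Qed.

End StationaryPerturbation.

(** * Uniform lower bound on the stationary distributions *)

Lemma finite_uniform_pos (R : realType) (I : finType) (P : I -> R -> Prop) :
  (forall i x y, 0 < x <= y -> P i y -> P i x) ->
  (forall i, exists2 x, 0 < x & P i x) -> exists2 x, 0 < x & forall i, P i x.
Proof.
move=> Pmon Pex.
have /boolp.choice[f fP] : forall i, exists x, 0 < x /\ P i x.
  by move=> i; case: (Pex i) => x; exists x.
exists (\big[Num.min/1]_i f i).
  by elim/big_ind: _ => // [x y x0 y0|i _]; rewrite ?lt_min ?x0 //; case: (fP i).
move=> i; have [fi0 fiP] := fP i; apply: Pmon fiP; rewrite bigmin_le_cond // andbT.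
by elim/big_ind: _ => // [x y x0 y0|j _]; rewrite ?lt_min ?x0 //; case: (fP j).
Qed.

Lemma sum_dirac (R : realType) (A : finType) (a : A) (f : A -> R) :
  \sum_b (b == a)%:R * f b = f a.
Proof.
rewrite (bigD1 a) //= eqxx mul1r big1 ?addr0 // => b /negbTE ->.
by rewrite mul0r.
Qed.

Definition fdirac (R : realType) (A : finType) (a : A) : fdist R A.
Proof.
refine (@FDist R A (fun b => (b == a)%:R) _ _) => [b|]; first exact: ler0n.
by rewrite -[RHS](sum_dirac a (fun=> 1)); apply: eq_bigr => b _; rewrite mulr1.
Defined.

Section StationaryLowerBound.
Context {R : realType} {S A : finType}.
Variables (M : mdp R S A) (pi_b : policy R S A) (nu : policy R S A -> fdist R S).
Hypotheses (h_explore : forall s a, 0 < pi_b s a)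
  (h_irr : forall pi, irreducible_kernel (composed_kernel M pi_b pi))
  (h_nu : forall pi, stationary (composed_kernel M pi_b pi) (nu pi)).
Implicit Types (G : {set S}) (pi : policy R S A).

Lemma stochastic_state_kernel pi : stochastic (state_kernel M pi).
Proof.
split=> [s s'|s].
  by apply: sumr_ge0 => a _; rewrite mulr_ge0 ?fdist_ge0.
rewrite exchange_big /= -[RHS](fdist_sum1 (pi s)); apply: eq_bigr => a _.
by rewrite -mulr_sumr fdist_sum1 mulr1.
Qed.

Lemma stochastic_composed pi : stochastic (composed_kernel M pi_b pi).
Proof. by apply: stochastic_kcomp; exact: stochastic_state_kernel. Qed.

(* Otherwise the policy choosing, at each reachable intermediate state, an action
   that avoids G would never enter G from outside. *)
Lemma unavoidable_entry G : G != finset.set0 -> G != [set: S]%SET ->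
  exists s a u, [/\ s \notin G, 0 < trans M s a u &
    forall a', 0 < \sum_(s' in G) trans M u a' s'].
Proof.
case/set0Pn => s1 s1G GT; apply: contrapT => Nex.
have [s0 s0G] : exists s0, s0 \notin G.
  apply/existsP; move: GT; apply: contraNT; rewrite negb_exists => /forallP GT.
  by apply/eqP/setP => s; rewrite inE; apply/negPn.
have avoid s a u : s \notin G -> 0 < trans M s a u ->
    exists a', \sum_(s' in G) trans M u a' s' == 0.
  move=> sG tr; apply: contrapT => Na; apply: Nex; exists s, a, u; split=> // a'.
  rewrite lt_neqAle eq_sym sumr_ge0 ?andbT => [|*]; last exact: fdist_ge0.
  by apply/negP => Ha; apply: Na; exists a'.
have [a0 _] : exists a0 : A, true.
  apply: contrapT => Na; have := fdist_sum1 (pi_b s0).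
  rewrite big1 => [/eqP|a _]; first by rewrite eq_sym oner_eq0.
  by case: Na; exists a.
pose f u := odflt a0 [pick a' | \sum_(s' in G) trans M u a' s' == 0].
pose pi : policy R S A := fun u => fdirac R (f u).
have K0 s s' : s \notin G -> s' \in G -> composed_kernel M pi_b pi s s' = 0.
  move=> sG s'G; apply: big1 => u _.
  have -> : state_kernel M pi u s' = trans M u (f u) s' by exact: sum_dirac.
  have [->|ne0] := eqVneq (state_kernel M pi_b s u) 0; first by rewrite mul0r.
  have [a tr] : exists a, 0 < trans M s a u.
    apply: contrapT => Na; case/negP: ne0; rewrite /state_kernel big1 // => a _.
    apply/eqP; rewrite mulf_eq0; apply/orP; right; apply/negPn/negP => t0.
    by apply: Na; exists a; rewrite lt_neqAle eq_sym t0 fdist_ge0.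
  have [a' Ha'] := avoid s a u sG tr.
  have : \sum_(s' in G) trans M u (f u) s' == 0.
    by rewrite /f; case: pickP => [//|/(_ a')]; rewrite Ha'.
  rewrite psumr_eq0 => [/allP/(_ s')|*]; last exact: fdist_ge0.
  by rewrite mem_index_enum s'G => /(_ isT)/eqP ->; rewrite mulr0.
have Kt0 t s : s \notin G -> kpow (composed_kernel M pi_b pi) t s s1 = 0.
  elim: t s => [|t IH] s sG /=.
    by case: eqVneq => // E; rewrite E s1G in sG.
  apply: big1 => u _; have [uG|uG] := boolP (u \in G).
    by rewrite K0 // mul0r.
  by rewrite IH // mulr0.
by have [t] := h_irr pi s0 s1; rewrite Kt0 // ltxx.
Qed.

(** The step from s to the intermediate state u is driven by [pi_b], hence independent of the
    policy; from u every action enters G, so the bound holds for any mixture of actions. *)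
Lemma uniform_entry : exists2 d : R, 0 < d & forall G, G != finset.set0 -> G != [set: S]%SET ->
  exists2 s, s \notin G & forall pi,
    d <= \sum_(s' in G) composed_kernel M pi_b pi s s'.
Proof.
pose P G (d : R) := G != finset.set0 -> G != [set: S]%SET ->
  exists2 s, s \notin G & forall pi,
    d <= \sum_(s' in G) composed_kernel M pi_b pi s s'.
apply: (@finite_uniform_pos R _ P) => [G x y /andP[_ xy] HG G0 GT|G].
  by have [s sG Hs] := HG G0 GT; exists s => // pi; exact: le_trans xy _.
have [G0|G0] := boolP (G != finset.set0); last by exists 1 => // /(negP G0).
have [GT|GT] := boolP (G != [set: S]%SET); last by exists 1 => // _ /(negP GT).
have [s [a [u [sG tr ent]]]] := unavoidable_entry G0 GT.
have [c c0 cP] : exists2 c : R, 0 < c & forall a', c <= \sum_(s' in G) trans M u a' s'.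
  apply: finite_uniform_pos => [a' x y /andP[_ xy]|a']; first exact: le_trans.
  by exists (\sum_(s' in G) trans M u a' s') => //; exact: ent.
exists (pi_b s a * trans M s a u * c); first by rewrite !mulr_gt0.
move=> _ _; exists s => // pi.
have ge0 pi' x y : 0 <= state_kernel M pi' x y by case: (stochastic_state_kernel pi').
have -> : \sum_(s' in G) composed_kernel M pi_b pi s s'
    = \sum_v state_kernel M pi_b s v * \sum_(s' in G) state_kernel M pi v s'.
  rewrite exchange_big /=; apply: eq_bigr => v _; by rewrite mulr_sumr.
rewrite (bigD1 u) //= -[leLHS]addr0 lerD ?sumr_ge0 //; last first.
  by move=> v _; rewrite mulr_ge0 // sumr_ge0.
apply: ler_pM; rewrite ?mulr_ge0 ?(ltW c0) ?fdist_ge0 //.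
  rewrite /state_kernel (bigD1 a) //= lerDl sumr_ge0 // => b _.
  by rewrite mulr_ge0 ?fdist_ge0.
rewrite exchange_big /= -[leLHS]mul1r -(fdist_sum1 (pi u)) mulr_suml.
apply: ler_sum => b _; rewrite -mulr_sumr ler_wpM2l ?fdist_ge0 //.
Qed.

(** Induction on the size of the complement of G, ending at singletons. Stationarity gives nu G >= d
    nu(s) for the state s outside G from [uniform_entry], while G with s added has mass at least e
    by induction; eliminating nu(s) leaves nu G >= e d / (1 + d). *)
Lemma stationary_lower_bound : exists2 e : R, 0 < e & forall pi s, e <= nu pi s.
Proof.
have [d d0 dP] := uniform_entry.
suff [e e0 eP] : exists2 e : R, 0 < e & forall G, G != finset.set0 -> (#|~: G| <= #|S|)%N ->
    forall pi, e <= \sum_(s in G) nu pi s.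
  exists e => // pi s.
  have := eP [set s]%SET _ (max_card _) pi; rewrite big_set1; apply.
  by apply/set0Pn; exists s; rewrite inE.
elim: #|S| => [|n [e e0 IH]].
  exists 1 => // G _; rewrite leqn0 cards_eq0 => /eqP G0 pi.
  rewrite -(fdist_sum1 (nu pi)) le_eqVlt; apply/orP; left; apply/eqP.
  by apply: eq_bigl => s; rewrite -[G]finset.setCK G0 !inE.
exists (e * d / (1 + d)); first by rewrite divr_gt0 ?mulr_gt0 ?addr_gt0.
move=> G G0 cG pi; rewrite ler_pdivrMr ?addr_gt0 //.
have nuG0 : 0 <= \sum_(s in G) nu pi s by rewrite sumr_ge0 // => *; exact: fdist_ge0.
have [GT|GT] := eqVneq G [set: S]%SET.
  have : e <= \sum_(s in G) nu pi s by apply: IH; rewrite // GT finset.setCT cards0.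
  move=> /(ler_wpM2r (ltW d0)); lra.
have [s sG sP] := dP G G0 GT.
have : d * nu pi s <= \sum_(s in G) nu pi s.
  have -> : \sum_(s in G) nu pi s
      = \sum_x nu pi x * \sum_(s' in G) composed_kernel M pi_b pi x s'.
    under eq_bigr => s' _ do rewrite -(h_nu pi s').
    by rewrite exchange_big /=; apply: eq_bigr => x _; rewrite mulr_sumr.
  rewrite (bigD1 s) //= mulrC -[leLHS]addr0 lerD ?ler_wpM2l ?fdist_ge0 //.
  rewrite sumr_ge0 // => x _; rewrite mulr_ge0 ?fdist_ge0 // sumr_ge0 // => y _.
  by case: (stochastic_composed pi).
have : e <= nu pi s + \sum_(s in G) nu pi s.
  rewrite -(big_setU1 _ sG) /=; apply: IH.
    by apply/set0Pn; exists s; rewrite !inE eqxx.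
  rewrite -ltnS (leq_trans _ cG) //; apply: proper_card.
  rewrite finset.properC; apply/properP; split; first exact: finset.subsetUr.
  by exists s => //; rewrite !inE eqxx.
by move=> /(ler_wpM2r (ltW d0)); lra.
Qed.

Lemma sigma_min_le pi s a : sigma_min pi_b nu <= nu pi s * pi_b s a.
Proof.
apply: ge_inf; last by exists pi, s, a.
by exists 0 => _ [pi' [s' [a' ->]]]; rewrite mulr_ge0 ?fdist_ge0.
Qed.

Lemma sigma_min_gt0 (s0 : S) : 0 < sigma_min pi_b nu.
Proof.
have [e e0 eP] := stationary_lower_bound.
have [b b0 bP] : exists2 b : R, 0 < b & forall x : S * A, b <= pi_b x.1 x.2.
  apply: finite_uniform_pos => [x y z /andP[_ xy]|x]; first exact: le_trans.
  by exists (pi_b x.1 x.2).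
apply: (@lt_le_trans _ _ (e * b)); first exact: mulr_gt0.
apply: lb_le_inf => [|_ [pi [s [a ->]]]].
  have [a _] : exists a0 : A, true.
    apply: contrapT => Na; have := fdist_sum1 (pi_b s0).
    rewrite big1 => [/eqP|a _]; first by rewrite eq_sym oner_eq0.
    by case: Na; exists a.
  by exists (nu pi_b s0 * pi_b s0 a), pi_b, s0, a.
by apply: ler_pM => //; [exact: ltW|exact: ltW|exact: (bP (s, a))].
Qed.

End StationaryLowerBound.

(** * Value functions *)

Lemma big_tuple0 (R : nmodType) (T : finType) (F : 0.-tuple T -> R) :
  \sum_w F w = F [tuple].
Proof. by rewrite (big_pred1 [tuple]) // => w; apply/esym/eqP; exact: tuple0. Qed.

Lemma big_tuple_cons (R : nmodType) (T : finType) n (F : n.+1.-tuple T -> R) :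
  \sum_w F w = \sum_x \sum_(w : n.-tuple T) F [tuple of x :: w].
Proof.
rewrite pair_big /= (reindex (fun xw : T * n.-tuple T => [tuple of xw.1 :: xw.2])) //=.
exists (fun w => (thead w, [tuple of behead w])) => [[x w] _|w _] /=.
  by congr pair; exact: val_inj.
by rewrite -tuple_eta.
Qed.

Section ValueFunction.
Context {R : realType} {S A : finType}.
Variable M : mdp R S A.
Implicit Types (pi : policy R S A) (s : S).

Local Notation g := (discount M).

Definition action_value pi s a : R :=
  reward M s a + g * \sum_s' trans M s a s' * value M pi s'.

Let g0 : 0 <= g := discount_ge0 M.
Let g1 : g < 1 := discount_lt1 M.

Definition horizon_value pi n s : R :=
  \sum_(w : n.-tuple (A * S)) traj_law M pi s w * traj_return M s w.

(** The two sides use different [nth] defaults, hence the bound on [t]. *)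
Lemma traj_state_cons s x (w : seq (A * S)) t : (t <= size w)%N ->
  traj_state s (x :: w) t.+1 = traj_state x.2 w t.
Proof. by move=> tw; apply: set_nth_default; rewrite /= size_map. Qed.

Lemma traj_law_cons pi s x n (w : n.-tuple (A * S)) :
  traj_law M pi s [tuple of x :: w] = pi s x.1 * trans M s x.1 x.2 * traj_law M pi x.2 w.
Proof.
rewrite /traj_law big_ord_recl; congr (_ * _); apply: eq_bigr => t _.
by rewrite !tnthS traj_state_cons // size_tuple ltnW.
Qed.

Lemma traj_return_cons s x n (w : n.-tuple (A * S)) :
  traj_return M s [tuple of x :: w] = reward M s x.1 + g * traj_return M x.2 w.
Proof.
rewrite /traj_return big_ord_recl expr0 mul1r mulr_sumr; congr (_ + _).
apply: eq_bigr => t _.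
rewrite tnthS [traj_state _ _ _]traj_state_cons ?size_tuple; last exact: ltnW.
by rewrite mulrA -exprS.
Qed.

Lemma sum_pi_trans pi s (f : A -> S -> R) :
  \sum_x pi s x.1 * trans M s x.1 x.2 * f x.1 x.2
    = \sum_a pi s a * \sum_s' trans M s a s' * f a s'.
Proof.
rewrite -(pair_bigA _ (fun a s' => pi s a * trans M s a s' * f a s')) /=.
by apply: eq_bigr => a _; rewrite mulr_sumr; apply: eq_bigr => s' _; rewrite mulrA.
Qed.

Lemma traj_law_sum1 pi s n : \sum_(w : n.-tuple (A * S)) traj_law M pi s w = 1.
Proof.
elim: n s => [|n IH] s.
  rewrite big_tuple0.
  by rewrite /traj_law big_ord0.
rewrite big_tuple_cons -[RHS](fdist_sum1 (pi s)).
transitivity (\sum_x pi s x.1 * trans M s x.1 x.2 * 1).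
  apply: eq_bigr => x _; rewrite -(IH x.2) mulr_sumr.
  by apply: eq_bigr => w _; rewrite traj_law_cons.
rewrite (sum_pi_trans pi s (fun _ _ => 1)); apply: eq_bigr => a _.
by under eq_bigr do rewrite mulr1; rewrite fdist_sum1 mulr1.
Qed.

Lemma horizon_value0 pi s : horizon_value pi 0 s = 0.
Proof.
rewrite /horizon_value big_tuple0.
by rewrite /traj_return big_ord0 mulr0.
Qed.

Lemma horizon_valueS pi n s : horizon_value pi n.+1 s =
  \sum_a pi s a * (reward M s a + g * \sum_s' trans M s a s' * horizon_value pi n s').
Proof.
rewrite /horizon_value big_tuple_cons.
transitivity (\sum_x pi s x.1 * trans M s x.1 x.2 *
    (reward M s x.1 + g * horizon_value pi n x.2)).
  apply: eq_bigr => x _; rewrite mulrDr -[X in X * reward _ _ _]mulr1.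
  rewrite -(traj_law_sum1 pi x.2 n) !mulr_sumr mulr_suml -big_split /=.
  apply: eq_bigr => w _; rewrite traj_law_cons traj_return_cons; ring.
rewrite (sum_pi_trans pi s (fun a s' => reward M s a + g * horizon_value pi n s')).
apply: eq_bigr => a _; congr (_ * _).
under eq_bigr do rewrite mulrDr mulrCA; rewrite big_split /= -mulr_suml -mulr_sumr.
by rewrite fdist_sum1 mul1r.
Qed.

Lemma horizon_value_ge0 pi n s : 0 <= horizon_value pi n s.
Proof.
elim: n s => [|n IH] s; first by rewrite horizon_value0.
rewrite horizon_valueS sumr_ge0 // => a _; rewrite mulr_ge0 ?fdist_ge0 // addr_ge0 //.
  exact: reward_ge0.
by rewrite mulr_ge0 // sumr_ge0 // => s' _; rewrite mulr_ge0 ?fdist_ge0.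
Qed.

Lemma fdist_mean_le (T : finType) (p : fdist R T) (f : T -> R) c :
  (forall x, f x <= c) -> \sum_x p x * f x <= c.
Proof.
move=> fc; rewrite -[leRHS]mul1r -(fdist_sum1 p) mulr_suml.
by apply: ler_sum => x _; rewrite ler_wpM2l ?fdist_ge0.
Qed.

Lemma horizon_value_le pi n s : horizon_value pi n s <= (1 - g)^-1.
Proof.
have gE : (1 - g)^-1 = 1 + g * (1 - g)^-1.
  by field; rewrite subr_eq0 eq_sym lt_eqF.
elim: n s => [|n IH] s; first by rewrite horizon_value0 invr_ge0 subr_ge0 ltW.
rewrite horizon_valueS; apply: fdist_mean_le => a; rewrite gE lerD ?reward_le1 //.
by rewrite ler_wpM2l //; apply: fdist_mean_le.
Qed.

(** Rewards are nonnegative, so the limit defining [value] exists by monotonicity and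
    boundedness. *)
Lemma horizon_value_nondecreasing pi s :
  nondecreasing_seq (fun n => horizon_value pi n s).
Proof.
apply/nondecreasing_seqP => n; elim: n s => [|n IH] s.
  by rewrite horizon_value0 horizon_value_ge0.
rewrite 2!horizon_valueS; apply: ler_sum => a _; rewrite ler_wpM2l ?fdist_ge0 //.
rewrite lerD2l ler_wpM2l //; apply: ler_sum => s' _.
by rewrite ler_wpM2l ?fdist_ge0.
Qed.

Lemma horizon_value_cvg pi s : horizon_value pi n s @[n --> \oo] --> value M pi s.
Proof.
apply: nondecreasing_is_cvgn; first exact: horizon_value_nondecreasing.
by exists (1 - g)^-1 => _ [n _ <-]; exact: horizon_value_le.
Qed.

Lemma value_ge0 pi s : 0 <= value M pi s.
Proof.
apply: limr_ge; first by apply/cvg_ex; exists (value M pi s); exact: horizon_value_cvg.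
by apply: nearW => n; exact: horizon_value_ge0.
Qed.

Lemma value_le pi s : value M pi s <= (1 - g)^-1.
Proof.
apply: limr_le; first by apply/cvg_ex; exists (value M pi s); exact: horizon_value_cvg.
by apply: nearW => n; exact: horizon_value_le.
Qed.

Lemma bellman_value pi s : value M pi s = \sum_a pi s a * action_value pi s a.
Proof.
have c1 : horizon_value pi n.+1 s @[n --> \oo] --> value M pi s.
  by rewrite (cvg_shiftS (fun n => horizon_value pi n s)); exact: horizon_value_cvg.
suff c2 : horizon_value pi n.+1 s @[n --> \oo] --> \sum_a pi s a * action_value pi s a.
  by apply: (cvg_unique _ c1 c2); exact: Rhausdorff.
under eq_cvg do rewrite horizon_valueS.
apply: cvg_big => [|a _]; first exact: add_continuous.
apply: cvgMl_tmp; apply: cvgD; first exact: cvg_cst.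
apply: cvgMl_tmp; apply: cvg_big => [|s' _]; first exact: add_continuous.
by apply: cvgMl_tmp; exact: horizon_value_cvg.
Qed.

Lemma bellman_action_value pi s a : action_value pi s a =
  reward M s a + g * \sum_s' trans M s a s' * \sum_a' pi s' a' * action_value pi s' a'.
Proof. by congr (_ + _ * _); apply: eq_bigr => s' _; rewrite bellman_value. Qed.

(** By [discounted_dual] with the difference of the two values as test function, it reduces to a
    one-step identity at each state, which is the Bellman equation of each policy. *)
Lemma performance_difference pi pi' (mu d : S -> R) :
  (forall s, d s = mu s + g * \sum_x d x * state_kernel M pi' x s) ->
  \sum_s mu s * (value M pi' s - value M pi s)
    = \sum_s d s * \sum_a (pi' s a - pi s a) * action_value pi s a.
Proof.
move=> dE; rewrite (discounted_dual _ dE); apply: eq_bigr => s _; congr (_ * _).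
under [RHS]eq_bigr do rewrite mulrBl; rewrite sumrB -bellman_value.
rewrite [value M pi' s]bellman_value addrAC; congr (_ - _).
have -> : \sum_y state_kernel M pi' s y * (value M pi' y - value M pi y)
    = \sum_a pi' s a * \sum_s' trans M s a s' * (value M pi' s' - value M pi s').
  rewrite /state_kernel; under eq_bigr do rewrite mulr_suml.
  rewrite exchange_big /=; apply: eq_bigr => a _; rewrite mulr_sumr.
  by apply: eq_bigr => s' _; rewrite mulrA.
rewrite mulr_sumr -sumrB; apply: eq_bigr => a _; rewrite mulrCA -mulrBr.
congr (_ * _); rewrite /action_value -addrA; congr (_ + _).
under [X in _ - g * X]eq_bigr do rewrite mulrBr.
by rewrite sumrB; ring.
Qed.

End ValueFunction.

(** * Expectations along a run *)

Section BatchExpectation.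
Context {R : realType} {S A : finType}.
Variables (M : mdp R S A) (pi_b : policy R S A).
Implicit Types (pi : policy R S A) (s : S).

Definition sample_law pi s (x : @Defs.sample S A) : R :=
  pi_b s (smp_a x) * trans M s (smp_a x) (smp_s' x) *
  pi (smp_s' x) (smp_a' x) * trans M (smp_s' x) (smp_a' x) (smp_next x).

Lemma sum_sample_law pi s (f : A -> S -> A -> S -> R) :
  \sum_x sample_law pi s x * f (smp_a x) (smp_s' x) (smp_a' x) (smp_next x)
  = \sum_a pi_b s a * \sum_s' trans M s a s' * \sum_a' pi s' a' *
      \sum_u trans M s' a' u * f a s' a' u.
Proof.
under [RHS]eq_bigr => a _.
  rewrite mulr_sumr; under eq_bigr => s' _.
    rewrite mulrA mulr_sumr; under eq_bigr => a' _.
      rewrite mulrA mulr_sumr; under eq_bigr => u _ do rewrite mulrA.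
      over.
    over.
  over.
by rewrite !pair_bigA.
Qed.

Lemma sum_sample_next pi s (f : S -> R) :
  \sum_x sample_law pi s x * f (smp_next x)
    = \sum_u composed_kernel M pi_b pi s u * f u.
Proof.
rewrite (sum_sample_law pi s (fun _ _ _ u => f u)).
rewrite /composed_kernel /Defs.kcomp /state_kernel.
under [RHS]eq_bigr do rewrite mulr_suml.
rewrite exchange_big /=.
under [RHS]eq_bigr => s' _.
  under eq_bigr => u _ do rewrite -mulrA.
  rewrite -mulr_sumr mulr_suml.
  over.
rewrite exchange_big /=; apply: eq_bigr => a _; rewrite mulr_sumr.
apply: eq_bigr => s' _; rewrite mulrA; congr (_ * _).
under [RHS]eq_bigr do rewrite mulr_suml.
rewrite exchange_big /=; apply: eq_bigr => a' _; rewrite mulr_sumr.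
by apply: eq_bigr => u _; rewrite mulrA.
Qed.

Lemma batch_state_cons s n x (w : n.-tuple (@Defs.sample S A)) t : (t <= n)%N ->
  batch_state s ([tuple of x :: w] : @batch S A n.+1) t.+1
    = batch_state (smp_next x) (w : @batch S A n) t.
Proof. by move=> tw; apply: set_nth_default; rewrite /= size_map size_tuple. Qed.

Lemma batch_law_cons pi s n x (w : n.-tuple (@Defs.sample S A)) :
  batch_law M pi_b pi s ([tuple of x :: w] : @batch S A n.+1)
    = sample_law pi s x * batch_law M pi_b pi (smp_next x) (w : @batch S A n).
Proof.
rewrite /batch_law big_ord_recl; congr (_ * _); apply: eq_bigr => t _.
by rewrite !tnthS batch_state_cons // ltnW.
Qed.

Lemma batch_law_ge0 pi s n (w : @batch S A n) : 0 <= batch_law M pi_b pi s w.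
Proof. by apply: prodr_ge0 => t _; rewrite !mulr_ge0 ?fdist_ge0. Qed.

Lemma batch_law_sum1 pi s n : \sum_(w : @batch S A n) batch_law M pi_b pi s w = 1.
Proof.
elim: n s => [|n IH] s.
  rewrite big_tuple0.
  by rewrite /batch_law big_ord0.
rewrite big_tuple_cons.
transitivity (\sum_x sample_law pi s x * 1).
  apply: eq_bigr => x _; rewrite -(IH (smp_next x)) mulr_sumr.
  by apply: eq_bigr => w _; rewrite batch_law_cons.
rewrite (sum_sample_next pi s (fun=> 1)).
have [_ K1] := stochastic_composed M pi_b pi; rewrite -[RHS](K1 s).
by apply: eq_bigr => u _; rewrite mulr1.
Qed.

(** The policy is frozen within a batch, so the states of a batch form a homogeneous chain and the
    law at time t is a power of a single kernel. Samples after time t integrate to 1. *)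
Lemma batch_expectation pi s n (t : 'I_n) (f : S -> @Defs.sample S A -> R) :
  \sum_(w : @batch S A n) batch_law M pi_b pi s w * f (batch_state s w t) (tnth w t)
  = \sum_u kpow (composed_kernel M pi_b pi) t s u * \sum_x sample_law pi u x * f u x.
Proof.
elim: n s t => [|n IH] s t; first by case: t.
rewrite big_tuple_cons; case: (unliftP ord0 t) => [t'|] -> /=.
  transitivity (\sum_x sample_law pi s x * \sum_u
      kpow (composed_kernel M pi_b pi) t' (smp_next x) u *
        \sum_x' sample_law pi u x' * f u x').
    apply: eq_bigr => x _; rewrite -IH mulr_sumr; apply: eq_bigr => w _.
    by rewrite batch_law_cons tnthS batch_state_cons 1?ltnW // mulrA.
  rewrite (sum_sample_next pi s (fun v => \sum_u
      kpow (composed_kernel M pi_b pi) t' v u * \sum_x' sample_law pi u x' * f u x')).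
  rewrite [RHS](_ : _ = \sum_u kpow (composed_kernel M pi_b pi) t'.+1 s u *
      \sum_x sample_law pi u x * f u x) //= /Defs.kcomp.
  under eq_bigr do rewrite mulr_sumr.
  rewrite exchange_big /=; apply: eq_bigr => u _; rewrite mulr_suml.
  by apply: eq_bigr => v _; rewrite mulrA.
under [RHS]eq_bigr do rewrite eq_sym.
rewrite sum_dirac; apply: eq_bigr => x _.
rewrite -[sample_law pi s x]mulr1 -(batch_law_sum1 pi (smp_next x) n) mulr_sumr mulr_suml.
by apply: eq_bigr => w _; rewrite batch_law_cons.
Qed.

Definition bellman_residual pi (Q : S -> A -> R) s a : R :=
  reward M s a + discount M * (\sum_s' trans M s a s' * \sum_a' pi s' a' * Q s' a') - Q s a.

Lemma td_error_expectation pi s0 n (t : 'I_n) Q s a :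
  \sum_(w : @batch S A n) batch_law M pi_b pi s0 w * td_error M Q s0 w t s a
  = kpow (composed_kernel M pi_b pi) t s0 s * pi_b s a * bellman_residual pi Q s a.
Proof.
pose f u (x : @Defs.sample S A) := if (u, smp_a x) == (s, a) then
  reward M u (smp_a x) + discount M * Q (smp_s' x) (smp_a' x) - Q u (smp_a x) else 0.
rewrite (batch_expectation pi s0 t f) (bigD1 s) //= [X in _ + X]big1; last first.
  move=> u us; rewrite big1 ?mulr0 // => x _.
  by rewrite /f xpair_eqE (negbTE us) mulr0.
rewrite addr0 -mulrA; congr (_ * _).
rewrite (sum_sample_law pi s (fun b s' a' _ => if (s, b) == (s, a) then
  reward M s b + discount M * Q s' a' - Q s b else 0)).
rewrite (bigD1 a) //= [X in _ + X]big1; last first.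
  move=> b ba; rewrite [X in _ * X]big1 ?mulr0 // => s' _.
  rewrite [X in _ * X]big1 ?mulr0 // => a' _.
  rewrite [X in _ * X]big1 ?mulr0 // => u _.
  by rewrite xpair_eqE (negbTE ba) andbF mulr0.
rewrite addr0 eqxx; congr (_ * _).
under eq_bigr => s' _.
  under eq_bigr => a' _.
    rewrite -mulr_suml fdist_sum1 mul1r addrAC mulrDr mulrCA.
    over.
  rewrite big_split /= -mulr_suml -mulr_sumr fdist_sum1 mul1r mulrDr mulrCA.
  over.
by rewrite big_split /= -mulr_suml -mulr_sumr fdist_sum1 mul1r addrAC.
Qed.

End BatchExpectation.

Section RunExpectation.
Context {R : realType} {S A : finType}.
Variables (M : mdp R S A) (h : 'rV[R]_#|A| -> \bar R) (pi_b : policy R S A).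
Variables (eta alpha : R) (B : nat) (c : nat -> R).
Implicit Types (x : @alg_state R S A) (F : @alg_state R S A -> R).

Local Notation step := (@alg_step R S A M h eta alpha B c).

(** The transition operator of the Markov chain formed by the algorithm states; including the policy
    and the batch start in the state is what makes it Markov. *)
Definition step_expectation F x : R :=
  \sum_(w : @batch S A B) batch_law M pi_b (next_policy h eta x) (alg_s x) w * F (step x w).

(** The law covers all [n] batches while the state at index [j] reads only the first [j]; the
    remaining ones integrate to 1. *)
Lemma run_expectation F n j x : (j <= n)%N ->
  \sum_(ws : n.-tuple (@batch S A B))
    (\prod_(k < n) let y := foldl step x (take k ws) in
       batch_law M pi_b (next_policy h eta y) (alg_s y) (tnth ws k))
    * F (foldl step x (take j ws))
  = iter j step_expectation F x.
Proof.
elim: n F j x => [|n IH] F j x.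
  rewrite leqn0 => /eqP ->.
  rewrite big_tuple0.
  by rewrite big_ord0 mul1r.
move=> jn; rewrite big_tuple_cons.
transitivity (step_expectation (fun y => \sum_(ws : n.-tuple (@batch S A B))
    (\prod_(k < n) let z := foldl step y (take k ws) in
       batch_law M pi_b (next_policy h eta z) (alg_s z) (tnth ws k))
    * (if j is j'.+1 then F (foldl step y (take j' ws)) else F x)) x).
  apply: eq_bigr => w _; rewrite mulr_sumr; apply: eq_bigr => ws _.
  rewrite big_ord_recl mulrA; congr (_ * _ * _); last by case: (j).
  by apply: eq_bigr => k _; rewrite tnthS.
case: j jn => [_|j jn]; last by apply: eq_bigr => w _; rewrite (IH F j).
rewrite -[RHS]mul1r.
rewrite -[X in _ = X * _](batch_law_sum1 M pi_b (next_policy h eta x) (alg_s x) B).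
rewrite mulr_suml; apply: eq_bigr => w _; congr (_ * _).
exact: (IH (fun=> F x) 0%N (step x w) (leq0n n)).
Qed.

Lemma expect_random_iterateE pi_0 s_0 K (f : policy R S A -> R) :
  expect_random_iterate M h pi_b eta alpha B c pi_0 s_0 K f
  = K.+1%:R^-1 * \sum_(k < K.+1) iter k step_expectation (fun x => f (alg_pi x))
      (AlgState (fun _ _ => 0) pi_0 s_0).
Proof.
rewrite /expect_random_iterate -(pair_bigA _ (fun ws (k : 'I_K.+1) =>
  run_law M h pi_b eta alpha c pi_0 s_0 ws / K.+1%:R *
  f (alg_pi (alg_at M h eta alpha c pi_0 s_0 ws k)))) /=.
rewrite exchange_big mulr_sumr; apply: eq_bigr => k _.
rewrite -(run_expectation (fun x => f (alg_pi x)) _ (ltnW (ltn_ord k))).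
rewrite mulr_sumr; apply: eq_bigr => ws _.
by rewrite mulrA [_^-1 * _]mulrC.
Qed.

Lemma step_expectation_le (I : @alg_state R S A -> Prop) F G x :
  (forall x w, I x -> I (step x w)) -> (forall x, I x -> F x <= G x) -> I x ->
  step_expectation F x <= step_expectation G x.
Proof.
move=> Istep FG Ix; apply: ler_sum => w _.
by rewrite ler_wpM2l ?batch_law_ge0 // FG //; exact: Istep.
Qed.

Lemma step_expectationD F G x :
  step_expectation (fun y => F y + G y) x = step_expectation F x + step_expectation G x.
Proof. by rewrite -big_split; apply: eq_bigr => w _; rewrite mulrDr. Qed.

Lemma step_expectationZ a F x :
  step_expectation (fun y => a * F y) x = a * step_expectation F x.
Proof. by rewrite /step_expectation mulr_sumr; apply: eq_bigr => w _; rewrite mulrCA. Qed.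

Lemma step_expectation_cst a x : step_expectation (fun=> a) x = a.
Proof. by rewrite /step_expectation -mulr_suml batch_law_sum1 mul1r. Qed.

(** A Lyapunov argument, by induction from the first step. The sum starts at one application of the
    operator because the drift inequality controls [F] after a step; [I] restricts it to states
    where the inequality is available. *)
Lemma drift_telescope (I : @alg_state R S A -> Prop) F (Phi : @alg_state R S A -> R) b lo x n :
  (forall x w, I x -> I (step x w)) ->
  (forall x, I x -> step_expectation F x <= Phi x - step_expectation Phi x + b) ->
  (forall x, I x -> lo <= Phi x) -> I x ->
  \sum_(k < n) iter k.+1 step_expectation F x <= Phi x - lo + n%:R * b.
Proof.
move=> Istep Hd Hlo; elim: n x => [|n IH] x Ix.
  by rewrite big_ord0 mul0r addr0 subr_ge0 Hlo.
rewrite big_ord_recl.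
have -> : \sum_(k < n) iter (lift ord0 k).+1 step_expectation F x
    = step_expectation (fun y => \sum_(k < n) iter k.+1 step_expectation F y) x.
  rewrite /step_expectation; under [RHS]eq_bigr do rewrite mulr_sumr.
  by rewrite exchange_big.
have : step_expectation (fun y => \sum_(k < n) iter k.+1 step_expectation F y) x
    <= step_expectation (fun y => Phi y + (n%:R * b - lo)) x.
  apply: (step_expectation_le Istep) => // y Iy.
  by rewrite addrA addrAC; exact: IH.
rewrite step_expectationD step_expectation_cst.
have := Hd x Ix; rewrite -natr1 /=; lra.
Qed.

End RunExpectation.

(** * Weights and mixing time *)

Section Weights.
Context {R : realType}.
Implicit Types (th kappa m : R).

Lemma geometric_sum_gt0 B th : (0 < B)%N -> 0 <= th -> 0 < \sum_(i < B) th ^+ i.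
Proof.
case: B => // B _ th0; rewrite big_ord_recl expr0 ltr_wpDr // sumr_ge0 // => i _.
exact: exprn_ge0.
Qed.

Lemma geometric_weight_ge0 B th t : 0 <= th -> 0 <= geometric_weight B th t.
Proof. by move=> th0; rewrite divr_ge0 ?exprn_ge0 // sumr_ge0 // => i _; exact: exprn_ge0. Qed.

Lemma geometric_weight_sum1 B th : (0 < B)%N -> 0 <= th ->
  \sum_(t < B) geometric_weight B th t = 1.
Proof.
move=> B0 th0; rewrite -mulr_suml (reindex_inj rev_ord_inj) /=.
rewrite (eq_bigr (fun i : 'I_B => th ^+ i)) => [|i _].
  by rewrite divff // gt_eqF // geometric_sum_gt0.
by rewrite subKn // subn1.
Qed.

Lemma geometric_sum_le kappa n : 0 <= kappa < 1 ->
  \sum_(t < n) kappa ^+ t <= (1 - kappa)^-1.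
Proof.
move=> /andP[k0 k1]; have k1' : 0 < 1 - kappa by rewrite subr_gt0.
rewrite -[leRHS]div1r ler_pdivlMr // mulrC -opprB mulNr -subrX1 opprB.
by rewrite gerBl exprn_ge0.
Qed.

Lemma geometric_convolution B (x y : R) :
  (x - y) * \sum_(t < B) y ^+ (B - t - 1) * x ^+ t = x ^+ B - y ^+ B.
Proof.
rewrite -[RHS]opprB subrXX -mulNr opprB; congr (_ * _); apply: eq_bigr => i _.
by rewrite subnAC subn1.
Qed.

(** The weighted sum is m C / Z, with C the convolution of two geometric sequences and Z the
    normalization of the weights. For th < 1 the bound Z >= 1 suffices; for th = 1 the exact value Z
    = B gives the decay in 1/B. *)
Lemma mixing_bias_le gamma B th m kappa : gamma < 1 -> (0 < B)%N ->
    0 <= th <= 1 -> 0 < m -> 0 < kappa < 1 ->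
  (\sum_(t < B) geometric_weight B th t * (m * kappa ^+ t)) / (1 - gamma)
    <= Psi gamma B th m kappa.
Proof.
move=> g1 B0 /andP[th0 th1] m0 /andP[k0 k1].
have q0 : 0 < 1 - gamma by rewrite subr_gt0.
pose C := \sum_(t < B) th ^+ (B - t - 1) * kappa ^+ t.
pose Z := \sum_(i < B) th ^+ i.
have Z0 : 0 < Z by exact: geometric_sum_gt0.
have Z1 : 1 <= Z.
  rewrite /Z; case: (B) B0 => // n _; rewrite big_ord_recl expr0 lerDl sumr_ge0 // => i _.
  exact: exprn_ge0.
have C0 : 0 <= C by apply: sumr_ge0 => t _; rewrite mulr_ge0 ?exprn_ge0 // ltW.
have -> : \sum_(t < B) geometric_weight B th t * (m * kappa ^+ t) = m * C / Z.
  rewrite mulr_sumr mulr_suml; apply: eq_bigr => t _; rewrite /geometric_weight -/Z.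
  by ring.
have CE : (kappa - th) * C = kappa ^+ B - th ^+ B by exact: geometric_convolution.
have mC : m * C / Z <= m * C by rewrite ler_pdivrMr // ler_peMr // mulr_ge0 // ltW.
rewrite /Psi; case: ltP => [tk|kt].
  have tk0 : 0 < kappa - th by rewrite subr_gt0.
  rewrite [leRHS](_ : _ = m * (kappa ^+ B / (kappa - th)) / (1 - gamma)); last first.
    by field; rewrite !gt_eqF.
  rewrite ler_pM2r ?invr_gt0 // (le_trans mC) // ler_pM2l // ler_pdivlMr // mulrC CE.
  by rewrite gerBl exprn_ge0.
case: eqP => [tk|/eqP ntk].
  rewrite [leRHS](_ : _ = m * (B%:R * th ^+ (B - 1)) / (1 - gamma)); last first.
    by field; rewrite gt_eqF.
  rewrite ler_pM2r ?invr_gt0 // (le_trans mC) // ler_pM2l // /C -tk.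
  rewrite (eq_bigr (fun=> th ^+ (B - 1))) => [|t _].
    by rewrite sumr_const card_ord mulr_natl.
  by rewrite -exprD; congr (_ ^+ _); have := ltn_ord t; lia.
have {ntk}kt : kappa < th by rewrite lt_neqAle eq_sym ntk.
have kt0 : 0 < th - kappa by rewrite subr_gt0.
case: ltP => [tl1|t1].
  rewrite [leRHS](_ : _ = m * (th ^+ B / (th - kappa)) / (1 - gamma)); last first.
    by field; rewrite !gt_eqF.
  rewrite ler_pM2r ?invr_gt0 // (le_trans mC) // ler_pM2l // ler_pdivlMr //.
  have : 0 <= kappa ^+ B by rewrite exprn_ge0 // ltW.
  lra.
have {t1 th1}th1 : th = 1 by apply/le_anti; rewrite th1 t1.
have ZB : Z = B%:R.
  by rewrite /Z th1; under eq_bigr do rewrite expr1n; rewrite sumr_const card_ord.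
have B0' : 0 < B%:R :> R by rewrite ltr0n.
rewrite ZB [leRHS](_ : _ = m * (1 - kappa)^-1 / B%:R / (1 - gamma)); last first.
  by field; rewrite !gt_eqF ?subr_gt0.
rewrite ler_pM2r ?invr_gt0 // ler_pM2r ?invr_gt0 // ler_pM2l //.
rewrite /C th1 (eq_bigr (fun t : 'I_B => kappa ^+ t)) => [|t _].
  by apply: geometric_sum_le; rewrite ltW.
by rewrite expr1n mul1r.
Qed.

End Weights.

(** * Summing the mixing bounds truncated at 1 *)

Section MixingTime.
Context {R : realType}.
Implicit Types (kappa m x : R).

Lemma ln_le_subr1 x : 0 < x -> ln x <= x - 1.
Proof.
move=> x0; rewrite -[leRHS]expRK ler_ln ?posrE ?expR_gt0 //.
by have := expR_ge1Dx (x - 1); rewrite addrC subrK.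
Qed.

Lemma ln_ge_1subV x : 0 < x -> 1 - x^-1 <= ln x.
Proof.
move=> x0; have := @ln_le_subr1 x^-1; rewrite invr_gt0 lnV ?posrE // => /(_ x0); lra.
Qed.

(** Since 2 <= (9/8)^6 and 1 + x <= exp x at x = 1/8. *)
Lemma ln2_le : ln (2 : R) <= 3 / 4.
Proof.
rewrite -[leRHS]expRK ler_ln ?posrE ?expR_gt0 //.
have -> : 3 / 4 = 6%:R * (1 / 8) :> R by lra.
rewrite expRM_natl; apply: (@le_trans _ _ ((1 + 1 / 8) ^+ 6)); first by lra.
by rewrite lerXn2r ?nnegrE ?expR_ge0 ?expR_ge1Dx //; lra.
Qed.

(** The first N terms cost at most 1 each, after which the tail is dominated by a geometric series.
    The induction on N absorbs one factor kappa into m. *)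
Lemma truncated_geometric_sum kappa m N n : 0 < kappa < 1 -> 0 <= m ->
  m * kappa ^+ N <= 1 ->
  \sum_(t < n) Num.min 1 (m * kappa ^+ t) <= N%:R + (1 - kappa)^-1.
Proof.
move=> k01; have /andP[k0 k1] := k01.
elim: N m n => [|N IH] m n m0.
  rewrite expr0 mulr1 add0r => m1.
  apply: le_trans (@geometric_sum_le _ kappa n _); last by rewrite ltW.
  apply: ler_sum => t _; rewrite ge_min; apply/orP; right.
  by rewrite ler_piMl // exprn_ge0 // ltW.
rewrite exprS mulrA => mN; case: n => [|n].
  by rewrite big_ord0 addr_ge0 // invr_ge0 subr_ge0 ltW.
rewrite big_ord_recl; apply: (@le_trans _ _ (1 + (N%:R + (1 - kappa)^-1))); last first.
  by rewrite -natr1; lra.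
apply: lerD; first by rewrite ge_min lexx.
have := IH (m * kappa) n (mulr_ge0 m0 (ltW k0)) mN.
by under eq_bigr do rewrite -mulrA -exprS.
Qed.

Let mixing_time kappa m : R := (Num.ceil (ln m^-1 / ln kappa))%:~R + (1 - kappa)^-1.

(* For m < 1 the ceiling is nonpositive, and m >= 1/2 is what keeps it under control. *)
Lemma mixing_time_bound kappa m : 0 < kappa < 1 -> 2^-1 <= m ->
  0 <= mixing_time kappa m /\
  forall n, \sum_(t < n) Num.min 1 (m * kappa ^+ t) <= 2 + 2 * mixing_time kappa m.
Proof.
move=> k01 m2; have /andP[k0 k1] := k01.
have q0 : 0 < 1 - kappa by rewrite subr_gt0.
have m0 : 0 < m by rewrite (lt_le_trans _ m2).
have lk : ln kappa <= - (1 - kappa) by have := ln_le_subr1 k0; lra.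
have lk0 : 0 < - ln kappa by lra.
have aE : ln m^-1 / ln kappa = ln m / (- ln kappa).
  by rewrite lnV ?posrE // mulNr invrN mulrN.
have ceil_le := Num.Theory.ceil_ge (ln m^-1 / ln kappa).
have [m1|m1] := leP 1 m.
  have a0 : 0 <= ln m^-1 / ln kappa by rewrite aE divr_ge0 ?ln_ge0 // ltW.
  have c0 : 0 <= Num.ceil (ln m^-1 / ln kappa).
    by rewrite -(ler_int R) (le_trans a0).
  (* The ceiling is the number of steps after which m kappa^N drops to at most 1. *)
  have [N NE] : exists N : nat, Num.ceil (ln m^-1 / ln kappa) = N.
    by exists `|Num.ceil (ln m^-1 / ln kappa)|%N; rewrite gez0_abs.
  have tau0 : 0 <= mixing_time kappa m.
    by rewrite /mixing_time NE addr_ge0 ?invr_ge0 ?(ltW q0).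
  split=> // n; apply: (@le_trans _ _ (mixing_time kappa m)); last by lra.
  rewrite /mixing_time NE; apply: truncated_geometric_sum => //; first exact: ltW.
  rewrite -ler_ln ?posrE ?mulr_gt0 ?exprn_gt0 // ln1 lnM ?posrE ?exprn_gt0 // lnXn //.
  move: ceil_le; rewrite NE aE ler_pdivrMr //= => H.
  by rewrite -mulr_natl; move: H; rewrite pmulrn /=; lra.
(* From ln (2 m) >= 1 - 1 / (2 m) and the bound on ln 2, this reduces to (m - 1/2) (m - 2) <= 0,
   true for m between 1/2 and 1. It yields half of m / (1 - kappa) as a lower bound on the mixing
   time, whence the factor 2 in the conclusion. *)
have lm : m / 2 <= 1 + ln m.
  have l1 : 1 - (2 * m)^-1 <= ln 2 + ln m.
    by rewrite -lnM ?posrE //; apply: ln_ge_1subV; rewrite mulr_gt0.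
  have l2 := ln2_le.
  suff : (2 * m)^-1 <= 5 / 4 - m / 2 by lra.
  rewrite -[leLHS]div1r ler_pdivrMr ?mulr_gt0 //.
  have : (m - 2^-1) * (m - 2) <= 0 by rewrite mulr_ge0_le0 ?subr_ge0 //; lra.
  lra.
have lln : ln m <= 0 by apply: ln_le0; exact: ltW.
(* As ln m is nonpositive, dividing it by the larger number - ln kappa brings it closer to 0. *)
have am : ln m / (1 - kappa) <= ln m / (- ln kappa).
  rewrite -lerN2 -!mulNr ler_wpM2l //; first by lra.
  by rewrite lef_pV2 ?posrE //; lra.
have tau : m / 2 / (1 - kappa) <= mixing_time kappa m.
  apply: (@le_trans _ _ (ln m / (1 - kappa) + (1 - kappa)^-1)).
    rewrite [leRHS](_ : _ = (1 + ln m) / (1 - kappa)); last by ring.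
    by rewrite ler_pM2r ?invr_gt0.
  by rewrite /mixing_time lerD2r (le_trans am) // -aE.
have tau0 : 0 <= mixing_time kappa m.
  by apply: le_trans tau; rewrite !divr_ge0 // ltW.
split=> // n; apply: (@le_trans _ _ (m / (1 - kappa))); last first.
  by have : m / (1 - kappa) = 2 * (m / 2 / (1 - kappa)); lra.
apply: (@le_trans _ _ (\sum_(t < n) m * kappa ^+ t)).
  by apply: ler_sum => t _; rewrite ge_min lexx orbT.
by rewrite -mulr_sumr ler_pM2l // geometric_sum_le // ltW.
Qed.

End MixingTime.

(** At time 0 the distance to a point mass at s is at least 1 - nu(s), and two distinct states
    cannot both have mass above 1/2. *)
Lemma tv_dist_dirac_ge (R : realType) (S : finType) (nu : fdist R S)
    (K : S -> S -> R) (m : R) : (1 < #|S|)%N ->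
  (forall s, tv_dist nu (kpow K 0 s) <= m) -> 2^-1 <= m.
Proof.
move=> S1 tv; have /card_gt1P[x [y [_ _ xy]]] := S1.
have le1 s : 1 - nu s <= m.
  apply: le_trans (tv s).
  apply: le_trans (tv_dist_coord s _); last first.
    by rewrite fdist_sum1 (bigD1 s) //= eqxx big1 ?addr0 // => z /negbTE;
      rewrite eq_sym => ->.
  by rewrite /= eqxx distrC ler_norm.
have : nu x + nu y <= 1.
  rewrite -(fdist_sum1 nu) (bigD1 x) //= (bigD1 y) 1?eq_sym //= lerD2l lerDl.
  by apply: sumr_ge0 => *; exact: fdist_ge0.
by have := le1 x; have := le1 y; lra.
Qed.

(** The step size equalizes a term decreasing in eta (initial divergence) with one increasing in eta
    (policy drift); both equalities are checked by comparing squares. *)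
Lemma optimal_step_size (R : rcfType) (P W D N q : R) :
  0 < P -> 0 < W -> 0 < D -> 0 < N -> 0 < q ->
  let eta := Num.sqrt (P * D / (W * N)) in
  let T := Num.sqrt (W * D / (P * q ^+ 2)) / Num.sqrt N in
  D / (eta * q * N) = T /\ eta * W / (P * q) = T.
Proof.
move=> P0 W0 D0 N0 q0 eta T.
have eta0 : 0 < eta by rewrite sqrtr_gt0 divr_gt0 ?mulr_gt0.
have eta2 : eta ^+ 2 = P * D / (W * N) by rewrite sqr_sqrtr // ltW // divr_gt0 ?mulr_gt0.
have T2 : T ^+ 2 = W * D / (P * q ^+ 2 * N).
  rewrite expr_div_n !sqr_sqrtr ?(ltW N0) //.
    by field; rewrite !gt_eqF.
  by rewrite ltW // divr_gt0 ?mulr_gt0 ?exprn_gt0.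
have T0 : 0 <= T by rewrite divr_ge0 ?sqrtr_ge0.
have sqr_inj a : 0 <= a -> a ^+ 2 = T ^+ 2 -> a = T.
  by move=> a0 /eqP; rewrite eqrXn2 // => /eqP.
split; apply: sqr_inj.
- by rewrite divr_ge0 ?mulr_ge0 ?ltW.
- by rewrite T2 expr_div_n !exprMn eta2; field; rewrite !gt_eqF.
- by rewrite divr_ge0 ?mulr_ge0 ?ltW.
- by rewrite T2 expr_div_n !exprMn eta2; field; rewrite !gt_eqF.
Qed.

(** * Dual weights and the potential *)

Section DualWeights.
Context {R : realType} {S A : finType}.
Variables (M : mdp R S A) (pi_b pi_star : policy R S A) (mu : fdist R S).
Variables (nu : policy R S A -> fdist R S) (sg : R).
Hypotheses (sg0 : 0 < sg) (sg_le : forall pi s a, sg <= nu pi s * pi_b s a).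
Implicit Types (pi : policy R S A) (x y : S * A) (Q : S -> A -> R).

Local Notation g := (discount M).

Let g0 : 0 <= g := discount_ge0 M.
Let g1 : g < 1 := discount_lt1 M.
Let q0 : 0 < 1 - g. Proof. by rewrite subr_gt0. Qed.

Definition state_action_kernel pi x y : R := trans M x.1 x.2 y.1 * pi y.1 y.2.

Lemma stochastic_state_action pi : stochastic (state_action_kernel pi).
Proof.
split=> [x y|x]; first by rewrite mulr_ge0 ?fdist_ge0.
rewrite -(pair_bigA _ (fun s a => trans M x.1 x.2 s * pi s a)) /=.
rewrite -[RHS](fdist_sum1 (trans M x.1 x.2)); apply: eq_bigr => s _.
by rewrite -mulr_sumr fdist_sum1 mulr1.
Qed.

Definition occupancy : S -> R :=
  sval (cid (discounted_exists g0 g1 mu (stochastic_state_kernel M pi_star))).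

Lemma occupancyE s :
  occupancy s = mu s + g * \sum_x occupancy x * state_kernel M pi_star x s.
Proof. by rewrite /occupancy; case: cid => d /= dE; exact: dE. Qed.

Lemma occupancy_ge0 s : 0 <= occupancy s.
Proof.
apply: (discounted_ge0 g0 g1 (stochastic_state_kernel M pi_star) _ occupancyE).
exact: fdist_ge0.
Qed.

Lemma occupancy_mass : \sum_s occupancy s = (1 - g)^-1.
Proof.
rewrite (discounted_mass g1 (stochastic_state_kernel M pi_star) occupancyE).
by rewrite fdist_sum1 div1r.
Qed.

Definition advantage_weight pi x : R :=
  occupancy x.1 * (pi_star x.1 x.2 - pi x.1 x.2).

Definition discounted_weight pi : S * A -> R :=
  sval (cid (discounted_exists g0 g1 (advantage_weight pi) (stochastic_state_action pi))).

Lemma discounted_weightE pi y : discounted_weight pi y =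
  advantage_weight pi y + g * \sum_x discounted_weight pi x * state_action_kernel pi x y.
Proof. by rewrite /discounted_weight; case: cid => v /= vE; exact: vE. Qed.

(** Dividing by the stationary law of the sampled pairs cancels the frequency with which the update
    visits each pair. *)
Definition dual_weight pi x : R := discounted_weight pi x / (nu pi x.1 * pi_b x.1 x.2).

Definition policy_close pi pi' (z : R) := forall s, \sum_a `|pi' s a - pi s a| <= z.

Lemma advantage_weight_norm pi : \sum_x `|advantage_weight pi x| <= 2 / (1 - g).
Proof.
rewrite -(pair_bigA _ (fun s a => `|occupancy s * (pi_star s a - pi s a)|)) /=.
rewrite -occupancy_mass mulr_sumr; apply: ler_sum => s _.
apply: (@le_trans _ _ (\sum_a occupancy s * (pi_star s a + pi s a))).
  apply: ler_sum => a _; rewrite normrM ger0_norm ?occupancy_ge0 //.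
  rewrite ler_wpM2l ?occupancy_ge0 // (le_trans (ler_normB _ _)) //.
  by rewrite !ger0_norm ?fdist_ge0.
by rewrite -mulr_sumr big_split /= !fdist_sum1 mulrC.
Qed.

Lemma advantage_weight_close pi pi' (z : R) : policy_close pi pi' z ->
  \sum_x `|advantage_weight pi' x - advantage_weight pi x| <= z / (1 - g).
Proof.
move=> hz.
rewrite (eq_bigr (fun x => occupancy x.1 * `|pi' x.1 x.2 - pi x.1 x.2|)); last first.
  move=> x _; rewrite /advantage_weight -mulrBr normrM ger0_norm ?occupancy_ge0 //.
  by rewrite -[in RHS]normrN; congr (_ * `|_|); ring.
rewrite -(pair_bigA _ (fun s a => occupancy s * `|pi' s a - pi s a|)) /=.
rewrite -occupancy_mass mulr_sumr; apply: ler_sum => s _.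
by rewrite -mulr_sumr mulrC ler_wpM2r ?occupancy_ge0.
Qed.

Lemma discounted_weight_norm pi : \sum_x `|discounted_weight pi x| <= 2 / (1 - g) ^+ 2.
Proof.
apply: le_trans (discounted_norm g0 g1 (stochastic_state_action pi)
  (discounted_weightE pi)) _.
by rewrite expr2 invfM mulrA ler_pM2r ?invr_gt0 ?advantage_weight_norm.
Qed.

Lemma state_action_kernel_close pi pi' (z : R) x : policy_close pi pi' z ->
  \sum_y `|state_action_kernel pi' x y - state_action_kernel pi x y| <= z.
Proof.
move=> hz; rewrite (eq_bigr (fun y => trans M x.1 x.2 y.1 * `|pi' y.1 y.2 - pi y.1 y.2|)).
  rewrite -(pair_bigA _ (fun s a => trans M x.1 x.2 s * `|pi' s a - pi s a|)) /=.
  under eq_bigr do rewrite -mulr_sumr.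
  exact: fdist_mean_le.
by move=> y _; rewrite -mulrBr normrM ger0_norm ?fdist_ge0.
Qed.

Lemma composed_kernel_close pi pi' (z : R) s : policy_close pi pi' z ->
  \sum_s' `|composed_kernel M pi_b pi' s s' - composed_kernel M pi_b pi s s'| <= z.
Proof.
move=> hz; have [K0 K1] := stochastic_state_kernel M pi_b.
have Kz u : \sum_s' `|state_kernel M pi' u s' - state_kernel M pi u s'| <= z.
  apply: le_trans (hz u).
  apply: (@le_trans _ _ (\sum_s' \sum_a `|pi' u a - pi u a| * trans M u a s')).
    apply: ler_sum => s' _; rewrite -sumrB (le_trans (ler_norm_sum _ _ _)) //.
    apply: ler_sum => a _; rewrite -mulrBl normrM.
    by rewrite (ger0_norm (fdist_ge0 (trans M u a) _)).
  by rewrite exchange_big /=; apply: ler_sum => a _; rewrite -mulr_sumr fdist_sum1 mulr1.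
apply: (@le_trans _ _ (\sum_s' \sum_u state_kernel M pi_b s u *
    `|state_kernel M pi' u s' - state_kernel M pi u s'|)).
  apply: ler_sum => s' _; rewrite -sumrB (le_trans (ler_norm_sum _ _ _)) //.
  by apply: ler_sum => u _; rewrite -mulrBr normrM (ger0_norm (K0 _ _)).
rewrite exchange_big /= -[leRHS]mul1r -(K1 s) mulr_suml.
by apply: ler_sum => u _; rewrite -mulr_sumr ler_wpM2l.
Qed.

Lemma discounted_weight_close pi pi' (z : R) : 0 <= z -> policy_close pi pi' z ->
  \sum_x `|discounted_weight pi' x - discounted_weight pi x| <= 2 * z / (1 - g) ^+ 3.
Proof.
move=> z0 hz.
apply: le_trans (discounted_perturbation g0 g1 (stochastic_state_action pi')
  (discounted_weightE pi) (discounted_weightE pi')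
  (fun x => state_action_kernel_close x hz)) _.
rewrite exprS invfM mulrA [_ / (1 - g) / _]mulrAC ler_pM2r ?invr_gt0 //.
apply: (@le_trans _ _ (z / (1 - g) + g * (2 / (1 - g) ^+ 2) * z)).
  rewrite lerD ?advantage_weight_close // ler_wpM2r // ler_wpM2l //.
  exact: discounted_weight_norm.
(* The first summand comes from the change of the source, the second from the change of the kernel;
   they add up to a factor 1 + g, at most 2. *)
have -> : z / (1 - g) + g * (2 / (1 - g) ^+ 2) * z = (1 + g) * z / (1 - g) ^+ 2.
  by field; rewrite gt_eqF.
by rewrite ler_pM2r ?invr_gt0 ?exprn_gt0 // ler_wpM2r //; have := g1; lra.
Qed.

Let den_gt0 pi x : 0 < nu pi x.1 * pi_b x.1 x.2.
Proof. exact: lt_le_trans (sg_le _ _ _). Qed.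

Lemma dual_weight_norm pi : \sum_x `|dual_weight pi x| <= 2 / (sg * (1 - g) ^+ 2).
Proof.
apply: (@le_trans _ _ (\sum_x `|discounted_weight pi x| / sg)).
  apply: ler_sum => x _; rewrite normrM ler_wpM2l // normfV gtr0_norm //.
  by rewrite lef_pV2 ?posrE.
by rewrite -mulr_suml invfM mulrCA mulrC ler_pM2l ?invr_gt0 // discounted_weight_norm.
Qed.

Lemma dual_weight_close pi pi' (z c : R) : 0 <= z -> 0 <= c -> sg <= 1 ->
  policy_close pi pi' z -> (forall s, `|nu pi' s - nu pi s| <= z * c) ->
  \sum_x `|dual_weight pi' x - dual_weight pi x|
    <= 2 * (1 + c) * z / (sg ^+ 2 * (1 - g) ^+ 3).
Proof.
move=> z0 c0 sg1 hz hc; have zc0 : 0 <= z * c by exact: mulr_ge0.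
apply: (@le_trans _ _ (\sum_x (`|discounted_weight pi' x - discounted_weight pi x| / sg
    + `|discounted_weight pi x| * (z * c / sg ^+ 2)))).
  apply: ler_sum => x _.
  pose a := nu pi x.1 * pi_b x.1 x.2; pose a' := nu pi' x.1 * pi_b x.1 x.2.
  have a0 : 0 < a := den_gt0 pi x; have a0' : 0 < a' := den_gt0 pi' x.
  (* The change of numerator and the change of denominator are separated; both denominators are at
     least [sg]. *)
  have -> : dual_weight pi' x - dual_weight pi x =
      (discounted_weight pi' x - discounted_weight pi x) / a'
      + discounted_weight pi x * ((a - a') / (a * a')).
    by rewrite /dual_weight -/a -/a'; field; rewrite !gt_eqF.
  rewrite (le_trans (ler_normD _ _)) // lerD // normrM ler_wpM2l //.
    by rewrite normfV gtr0_norm // lef_pV2 ?posrE //; exact: sg_le.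
  rewrite normrM normfV (gtr0_norm (mulr_gt0 a0 a0')).
  apply: ler_pM; rewrite ?normr_ge0 ?invr_ge0 ?(ltW (mulr_gt0 a0 a0')) //.
    rewrite /a /a' -mulrBl normrM (ger0_norm (fdist_ge0 _ _)) distrC.
    by rewrite -[leRHS]mulr1 ler_pM ?fdist_ge0 ?fdist_le1.
  rewrite lef_pV2 ?posrE ?(mulr_gt0 a0 a0') ?exprn_gt0 // expr2.
  by apply: ler_pM; first [exact: ltW | exact: sg_le].
rewrite big_split /= -!mulr_suml.
apply: (@le_trans _ _ (2 * z / (1 - g) ^+ 3 / sg + 2 / (1 - g) ^+ 2 * (z * c / sg ^+ 2))).
  apply: lerD; first by rewrite ler_pM2r ?invr_gt0 // discounted_weight_close.
  by rewrite ler_wpM2r ?discounted_weight_norm // divr_ge0 // exprn_ge0 // ltW.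
rewrite [leLHS](_ : _ = (2 * z * sg + 2 * (1 - g) * (z * c)) / (sg ^+ 2 * (1 - g) ^+ 3)).
  rewrite ler_pM2r ?invr_gt0 ?mulr_gt0 ?exprn_gt0 //.
  have : z * sg <= z * 1 by rewrite ler_wpM2l.
  have : (1 - g) * (z * c) <= 1 * (z * c) by rewrite ler_wpM2r ?gerBl.
  lra.
by field; rewrite !gt_eqF.
Qed.

(** [discounted_dual] with the error of Q as test function: the operator I - g K^pi maps Q^pi - Q to
    the Bellman residual of Q. *)
Lemma advantage_residual pi Q :
  \sum_x advantage_weight pi x * (action_value M pi x.1 x.2 - Q x.1 x.2)
    = \sum_x discounted_weight pi x * bellman_residual M pi Q x.1 x.2.
Proof.
rewrite (discounted_dual _ (discounted_weightE pi)); apply: eq_bigr => x _.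
congr (_ * _); rewrite {1}bellman_action_value /bellman_residual.
have E f : \sum_y state_action_kernel pi x y * f y.1 y.2
    = \sum_s trans M x.1 x.2 s * \sum_a pi s a * f s a.
  rewrite -(pair_bigA _ (fun s a => trans M x.1 x.2 s * pi s a * f s a)) /=.
  by apply: eq_bigr => s _; rewrite mulr_sumr; apply: eq_bigr => a _; rewrite mulrA.
under [X in _ - g * X]eq_bigr do rewrite mulrBr.
by rewrite sumrB !E; ring.
Qed.

Lemma gap_advantage pi : optimal_policy M pi_star ->
  mean_at mu (opt_value M) - mean_at mu (value M pi)
    = \sum_x advantage_weight pi x * action_value M pi x.1 x.2.
Proof.
move=> hstar; rewrite -sumrB.
under eq_bigr do rewrite -mulrBr -hstar.
rewrite (performance_difference _ occupancyE).
rewrite -(pair_bigA _ (fun s a => advantage_weight pi (s, a) * action_value M pi s a)) /=.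
by apply: eq_bigr => s _; rewrite mulr_sumr; apply: eq_bigr => a _; rewrite mulrA.
Qed.

End DualWeights.

(** * Drift inequality for the potential *)

Section OneStep.
Context {R : realType} {S A : finType}.
Variables (M : mdp R S A) (h : 'rV[R]_#|A| -> \bar R).
Variables (pi_b pi_star : policy R S A) (mu : fdist R S).
Variables (nu : policy R S A -> fdist R S) (sg : R).
Variables (eta alpha : R) (B : nat) (c : nat -> R) (m kappa : R).
Hypotheses (h_mirror : mirror_map h) (sg0 : 0 < sg)
  (sg_le : forall pi s a, sg <= nu pi s * pi_b s a).
Hypotheses (h_mixing : forall (pi : policy R S A) (s : S) (t : nat),
  tv_dist (nu pi) (kpow (composed_kernel M pi_b pi) t s) <= m * kappa ^+ t).
Hypotheses (h_alpha : 0 < alpha <= 1) (c_ge0 : forall t, 0 <= c t)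
  (c_sum1 : \sum_(t < B) c t = 1).
Implicit Types (x : @alg_state R S A) (pi : policy R S A) (Q : S -> A -> R).

Local Notation g := (discount M).
Local Notation step := (@alg_step R S A M h eta alpha B c).
Local Notation next x := (next_policy h eta x).
Local Notation E := (step_expectation M h pi_b eta alpha B c).
Local Notation u := (dual_weight M pi_b pi_star mu nu).
Local Notation d := (occupancy M pi_star mu).

Let g0 : 0 <= g := discount_ge0 M.
Let g1 : g < 1 := discount_lt1 M.
Let q0 : 0 < 1 - g. Proof. by rewrite subr_gt0. Qed.
Let alpha0 : 0 < alpha. Proof. by case/andP: h_alpha. Qed.

Definition q_bounded Q := forall s a, 0 <= Q s a <= (1 - g)^-1.

Definition alg_inv x :=
  (forall s, (edom h)° (vec (alg_pi x s))) /\ q_bounded (alg_Q x).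

Definition gap pi : R := mean_at mu (opt_value M) - mean_at mu (value M pi).

Definition pairing (w : S * A -> R) Q : R := \sum_x w x * Q x.1 x.2.

Let bE : (1 - g)^-1 = 1 + g * (1 - g)^-1.
Proof. by field; rewrite gt_eqF. Qed.

Lemma td_target_bounds Q s a s' a' : q_bounded Q ->
  0 <= reward M s a + g * Q s' a' <= (1 - g)^-1.
Proof.
move=> hQ; have /andP[Q0 Q1] := hQ s' a'.
rewrite addr_ge0 ?reward_ge0 ?mulr_ge0 //= bE lerD ?reward_le1 //.
exact: ler_wpM2l.
Qed.

Lemma next_interior x : alg_inv x -> forall s, (edom h)° (vec (next x s)).
Proof. by case=> hpi _ s; exact: pmd_update_interior. Qed.

(** The new value of Q at each pair is a convex combination of the old value and of targets in
    [0, 1 / (1 - gamma)], since alpha <= 1 and the weights sum to 1; an unvisited pair has zero TD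
    error, as if its target were the old value. *)
Lemma alg_inv_step x w : alg_inv x -> alg_inv (step x w).
Proof.
move=> hx; split=> [s|s a]; first exact: next_interior.
case: hx => _ hQ; have /andP[Q0 Q1] := hQ s a; have /andP[_ alpha1] := h_alpha.
pose T := \sum_(t < B) c t * td_error M (alg_Q x) (alg_s x) w t s a.
have td t : - alg_Q x s a <= td_error M (alg_Q x) (alg_s x) w t s a
    <= (1 - g)^-1 - alg_Q x s a.
  rewrite /td_error; case: eqP => [[-> ->]|_]; last by rewrite oppr_le0 Q0 subr_ge0.
  have /andP[t0 t1] := td_target_bounds s a (smp_s' (tnth w t)) (smp_a' (tnth w t)) hQ.
  by apply/andP; split; lra.
have T0 : - alg_Q x s a <= T.
  rewrite -[leLHS]mul1r -c_sum1 mulr_suml; apply: ler_sum => t _.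
  by rewrite ler_wpM2l //; case/andP: (td t).
have T1 : T <= (1 - g)^-1 - alg_Q x s a.
  rewrite -[leRHS]mul1r -[X in _ <= X * _]c_sum1 mulr_suml; apply: ler_sum => t _.
  by rewrite ler_wpM2l //; case/andP: (td t).
rewrite /= -/T; apply/andP; split.
  have := ler_wpM2l (ltW alpha0) T0.
  have : 0 <= (1 - alpha) * alg_Q x s a by rewrite mulr_ge0 ?subr_ge0.
  lra.
have := ler_wpM2l (ltW alpha0) T1.
have : (1 - alpha) * alg_Q x s a <= (1 - alpha) * (1 - g)^-1.
  by rewrite ler_wpM2l ?subr_ge0.
lra.
Qed.

Lemma bellman_residual_le pi Q s a : q_bounded Q ->
  `|bellman_residual M pi Q s a| <= (1 - g)^-1.
Proof.
move=> hQ; have /andP[Q0 Q1] := hQ s a; rewrite /bellman_residual.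
set T := \sum_s' _; have T0 : 0 <= T.
  apply: sumr_ge0 => s' _; rewrite mulr_ge0 ?fdist_ge0 // sumr_ge0 // => a' _.
  by rewrite mulr_ge0 ?fdist_ge0 //; case/andP: (hQ s' a').
have T1 : T <= (1 - g)^-1.
  apply: fdist_mean_le => s'; apply: fdist_mean_le => a'.
  by case/andP: (hQ s' a').
have r0 := reward_ge0 M s a; have r1 := reward_le1 M s a.
have gT0 : 0 <= g * T by exact: mulr_ge0.
have gT1 : g * T <= g * (1 - g)^-1 by exact: ler_wpM2l.
by rewrite ler_norml; apply/andP; split; move: bE; lra.
Qed.

Lemma pairing_le w Q : q_bounded Q ->
  `|pairing w Q| <= (\sum_x `|w x|) * (1 - g)^-1.
Proof.
move=> hQ; rewrite (le_trans (ler_norm_sum _ _ _)) // mulr_suml.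
apply: ler_sum => x _; rewrite normrM ler_wpM2l //.
by have /andP[Q0 Q1] := hQ x.1 x.2; rewrite ger0_norm.
Qed.

Lemma expected_pairing x w :
  E (fun y => pairing w (alg_Q y)) x = pairing w (alg_Q x) + alpha * \sum_y w y *
    \sum_(t < B) c t * (kpow (composed_kernel M pi_b (next x)) t (alg_s x) y.1
      * pi_b y.1 y.2 * bellman_residual M (next x) (alg_Q x) y.1 y.2).
Proof.
pose law (b : @batch S A B) := batch_law M pi_b (next x) (alg_s x) b.
pose td b y := \sum_(t < B) c t * td_error M (alg_Q x) (alg_s x) b t y.1 y.2.
have -> : E (fun y => pairing w (alg_Q y)) x
    = \sum_y w y * \sum_b law b * (alg_Q x y.1 y.2 + alpha * td b y).
  transitivity (\sum_b \sum_y law b * (w y * (alg_Q x y.1 y.2 + alpha * td b y))).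
    by apply: eq_bigr => b _; rewrite /pairing mulr_sumr.
  rewrite exchange_big /=; apply: eq_bigr => y _; rewrite mulr_sumr.
  by apply: eq_bigr => b _; rewrite mulrCA.
rewrite /pairing mulr_sumr -big_split /=; apply: eq_bigr => y _.
rewrite [alpha * _]mulrCA -mulrDr; congr (_ * _).
rewrite -[X in X + _]mul1r -(batch_law_sum1 M pi_b (next x) (alg_s x) B).
transitivity (\sum_b law b * alg_Q x y.1 y.2 + alpha * \sum_b law b * td b y).
  by rewrite mulr_sumr -big_split /=; apply: eq_bigr => b _; ring.
rewrite -mulr_suml; congr (_ + _ * _).
transitivity (\sum_b \sum_(t < B) law b *
    (c t * td_error M (alg_Q x) (alg_s x) b t y.1 y.2)).
  by apply: eq_bigr => b _; rewrite mulr_sumr.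
rewrite exchange_big /=; apply: eq_bigr => t _; rewrite -td_error_expectation mulr_sumr.
by apply: eq_bigr => b _; rewrite mulrCA.
Qed.

(** If the batch states had the stationary law this would be an equality without the last term.
    Replacing that law by the powers of the kernel costs m kappa^t per coordinate, times a residual
    bounded by 1 / (1 - gamma). *)
Lemma expected_pairing_bias x Ps : alg_inv x ->
    (\sum_(t < B) c t * (m * kappa ^+ t)) / (1 - g) <= Ps ->
  \sum_y discounted_weight M pi_star mu (next x) y
      * bellman_residual M (next x) (alg_Q x) y.1 y.2
    <= (E (fun y => pairing (u (next x)) (alg_Q y)) x
        - pairing (u (next x)) (alg_Q x)) / alpha
      + (\sum_y `|u (next x) y|) * Ps.
Proof.
move=> [_ hQ] hPs; rewrite expected_pairing addrAC subrr add0r mulrC mulKf ?gt_eqF //.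
rewrite -lerBlDl -sumrB mulr_suml; apply: ler_sum => y _.
set res := bellman_residual _ _ _ _ _; set K := kpow _.
have dn0 : 0 < nu (next x) y.1 * pi_b y.1 y.2 by exact: lt_le_trans (sg_le _ _ _).
have -> : discounted_weight M pi_star mu (next x) y =
    u (next x) y * (nu (next x) y.1 * pi_b y.1 y.2).
  by rewrite /dual_weight divfK // gt_eqF.
rewrite -mulrA -mulrBr (le_trans (ler_norm _)) // normrM ler_wpM2l //.
have -> : nu (next x) y.1 * pi_b y.1 y.2 * res
      - \sum_(t < B) c t * (K t (alg_s x) y.1 * pi_b y.1 y.2 * res)
    = \sum_(t < B) c t * ((nu (next x) y.1 - K t (alg_s x) y.1) * (pi_b y.1 y.2 * res)).
  rewrite -[X in X - _]mul1r -c_sum1 mulr_suml -sumrB.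
  by apply: eq_bigr => t _; ring.
apply: le_trans hPs; rewrite mulr_suml (le_trans (ler_norm_sum _ _ _)) //.
apply: ler_sum => t _; rewrite normrM (ger0_norm (c_ge0 t)) -mulrA ler_wpM2l //.
rewrite normrM; apply: ler_pM => //.
  apply: le_trans (h_mixing (next x) (alg_s x) t); apply: tv_dist_coord.
  have [_ K1] := stochastic_kpow t (stochastic_composed M pi_b (next x)).
  by rewrite fdist_sum1 K1.
rewrite normrM (ger0_norm (fdist_ge0 _ _)) -[leRHS]mul1r.
by apply: ler_pM; rewrite ?fdist_ge0 ?fdist_le1 ?bellman_residual_le.
Qed.

Definition potential x : R :=
  (\sum_s d s * real_bregman h (vec (pi_star s)) (vec (alg_pi x s))) / eta
  - pairing (u (alg_pi x)) (alg_Q x) / alpha.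

Hypothesis h_star : optimal_policy M pi_star.
Hypothesis star_edom : forall s, edom h (vec (pi_star s)).

Lemma gap_split pi Q : gap pi = pairing (advantage_weight M pi_star mu pi) Q
  + \sum_y discounted_weight M pi_star mu pi y * bellman_residual M pi Q y.1 y.2.
Proof.
rewrite /gap (gap_advantage _ _ h_star) -advantage_residual -big_split /=.
by apply: eq_bigr => y _; ring.
Qed.

Lemma mirror_descent_gain x : 0 < eta -> alg_inv x ->
  pairing (advantage_weight M pi_star mu (next x)) (alg_Q x) <=
    (\sum_s d s * real_bregman h (vec (pi_star s)) (vec (alg_pi x s))) / eta
    - (\sum_s d s * real_bregman h (vec (pi_star s)) (vec (next x s))) / eta.
Proof.
move=> eta0 hx; rewrite -mulrBl ler_pdivlMr // mulrC -sumrB /pairing.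
rewrite -(pair_bigA _ (fun s a =>
  advantage_weight M pi_star mu (next x) (s, a) * alg_Q x s a)) /= mulr_sumr.
apply: ler_sum => s _; rewrite /advantage_weight /=.
have := pmd_update_three_point h_mirror eta (alg_Q x) (hx.1 s) (star_edom s).
(* The divergence from the current to the next policy has a favourable sign and is dropped. *)
have := bregman_interior_ge0 h_mirror (interior_edom (next_interior hx s)) (hx.1 s).
rewrite /next_policy => D0 tp.
under eq_bigr do rewrite -mulrA; rewrite -mulr_sumr mulrCA -mulrBr.
by rewrite ler_wpM2l ?occupancy_ge0 //; lra.
Qed.

Lemma one_step_drift x U Ps : 0 < eta -> alg_inv x ->
    \sum_y `|u (next x) y - u (alg_pi x) y| <= U ->
    (\sum_(t < B) c t * (m * kappa ^+ t)) / (1 - g) <= Ps -> 0 <= Ps ->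
  E (fun y => gap (alg_pi y)) x <= potential x - E potential x
    + (U / (alpha * (1 - g)) + 2 / (sg * (1 - g) ^+ 2) * Ps).
Proof.
move=> eta0 hx hU hPs Ps0.
(* The next policy is computed before the batch is drawn, so given x it is deterministic; for the
   same reason only Q is averaged in the expected potential. *)
have -> : E (fun y => gap (alg_pi y)) x = gap (next x).
  by rewrite -[RHS](step_expectation_cst M h pi_b eta alpha B c _ x).
have -> : E potential x =
    (\sum_s d s * real_bregman h (vec (pi_star s)) (vec (next x s))) / eta
    - E (fun y => pairing (u (next x)) (alg_Q y)) x / alpha.
  transitivity (E (fun y =>
      (\sum_s d s * real_bregman h (vec (pi_star s)) (vec (next x s))) / eta
      + (- alpha^-1) * pairing (u (next x)) (alg_Q y)) x).
    by apply: eq_bigr => w _; rewrite mulNr [alpha^-1 * _]mulrC.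
  by rewrite step_expectationD step_expectation_cst step_expectationZ mulNr [alpha^-1 * _]mulrC.
rewrite (gap_split _ (alg_Q x)) /potential.
have md := mirror_descent_gain eta0 hx.
have bias := expected_pairing_bias hx hPs.
have un : (\sum_y `|u (next x) y|) * Ps <= 2 / (sg * (1 - g) ^+ 2) * Ps.
  by rewrite ler_wpM2r // dual_weight_norm.
(* The potential pairs Q with the dual weight of the current policy, the critic step needs that of
   the next one; this is the cost of exchanging them. *)
have dr : pairing (u (alg_pi x)) (alg_Q x) / alpha
    - pairing (u (next x)) (alg_Q x) / alpha <= U / (alpha * (1 - g)).
  rewrite -mulrBl (_ : U / _ = U / (1 - g) / alpha); last by field; rewrite !gt_eqF.
  rewrite ler_pM2r ?invr_gt0 //.
  have -> : pairing (u (alg_pi x)) (alg_Q x) - pairing (u (next x)) (alg_Q x)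
      = pairing (fun y => u (alg_pi x) y - u (next x) y) (alg_Q x).
    by rewrite /pairing -sumrB; apply: eq_bigr => y _; rewrite mulrBl.
  rewrite (le_trans (ler_norm _)) // (le_trans (pairing_le _ hx.2)) //.
  rewrite ler_wpM2r ?invr_ge0 ?(ltW q0) //.
  by apply: le_trans hU; apply: ler_sum => y _; rewrite distrC.
move: md bias un dr; rewrite mulrBl; lra.
Qed.

Lemma potential_ge x : 0 < eta -> alg_inv x ->
  - (2 / (alpha * sg * (1 - g) ^+ 3)) <= potential x.
Proof.
move=> eta0 hx; rewrite /potential.
have D0 : 0 <= (\sum_s d s * real_bregman h (vec (pi_star s)) (vec (alg_pi x s))) / eta.
  rewrite divr_ge0 ?(ltW eta0) // sumr_ge0 // => s _.
  by rewrite mulr_ge0 ?occupancy_ge0 // bregman_interior_ge0 //; exact: hx.1.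
suff : pairing (u (alg_pi x)) (alg_Q x) / alpha <= 2 / (alpha * sg * (1 - g) ^+ 3).
  by lra.
rewrite (_ : 2 / _ = 2 / (sg * (1 - g) ^+ 2) * (1 - g)^-1 / alpha); last first.
  by field; rewrite !gt_eqF.
rewrite ler_pM2r ?invr_gt0 // (le_trans (ler_norm _)) // (le_trans (pairing_le _ hx.2)) //.
by rewrite ler_wpM2r ?invr_ge0 ?(ltW q0) // dual_weight_norm.
Qed.

Lemma gap_le pi : gap pi <= (1 - g)^-1.
Proof.
rewrite /gap /mean_at -sumrB -[leRHS]mul1r -[X in _ <= X * _](fdist_sum1 mu) mulr_suml.
apply: ler_sum => s _; rewrite -mulrBr ler_wpM2l ?fdist_ge0 // -h_star.
by have := value_le M pi_star s; have := value_ge0 M pi s; lra.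
Qed.

End OneStep.

(** * Lipschitz dependence of the stationary distribution on the policy *)

Section StationaryLipschitz.
Context {R : realType} {S A : finType}.
Variables (M : mdp R S A) (pi_b : policy R S A) (nu : policy R S A -> fdist R S).
Variables (m kappa : R).
Hypotheses
  (h_nu : forall pi : policy R S A, stationary (composed_kernel M pi_b pi) (nu pi))
  (h_kappa : 0 < kappa < 1)
  (h_mixing : forall (pi : policy R S A) (s : S) (t : nat),
     tv_dist (nu pi) (kpow (composed_kernel M pi_b pi) t s) <= m * kappa ^+ t).

Lemma stationary_lipschitz :
  let L := #|A|%:R * ((Num.ceil (ln m^-1 / ln kappa))%:~R + (1 - kappa)^-1) in
  (0 < #|S|)%N -> (0 < #|A|)%N -> (#|S| = 1%N -> 0 <= L) ->
  exists c : R, [/\ 0 <= c, 2 * (1 + c) <= 6 + 4 * L &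
    forall (pi pi' : policy R S A) z, 0 <= z -> policy_close pi pi' z ->
      forall s, `|nu pi' s - nu pi s| <= z * c].
Proof.
move=> L S0 A0 hL1; have [S1|S1] := leqP #|S| 1.
  have {}S1 : #|S| = 1%N by apply/eqP; rewrite eqn_leq S1.
  (* With one state every stationary distribution is the point mass; m may then be below 1/2, and
     the sign of L comes from the hypothesis. *)
  exists 0; split=> //; first by have := hL1 S1; lra.
  move=> pi pi' z _ _ s; rewrite mulr0.
  suff nu1 pi0 : nu pi0 s = 1 by rewrite !nu1 subrr normr0.
  have [s1 s1E] := fintype1 S1.
  by rewrite -(fdist_sum1 (nu pi0)) (big_pred1 s) // => s'; rewrite /= !s1E eqxx.
have [s _] : exists s : S, true by case/card_gt0P: S0 => s; exists s.
have m2 : 2^-1 <= m.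
  apply: (tv_dist_dirac_ge (nu := nu pi_b) (K := composed_kernel M pi_b pi_b) S1) => s'.
  by rewrite -[leRHS]mulr1 -(expr0 kappa).
have [l0 lS] := mixing_time_bound h_kappa m2.
set l := _ + _ in l0 lS.
(* This is the bound of [mixing_time_bound]; it gives 2 (1 + c) = 6 + 4 l, and L is |A| times l with
   l nonnegative. *)
exists (2 + 2 * l); split; first by lra.
  have : l <= L by rewrite /L -/l ler_peMl // ler1n.
  lra.
move=> pi pi' z z0 hz; apply: (stationary_perturbation
  (stochastic_composed M pi_b pi) (h_nu pi') h_kappa z0 (h_mixing pi) _ lS) => s'.
exact: composed_kernel_close.
Qed.

End StationaryLipschitz.

(** * Choice of the step size and assembly of the constants *)

Theorem theorem4p11 (R : realType) (S A : finType) (M : mdp R S A)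
    (h : 'rV[R]_#|A| -> \bar R) (lam : R) (p : \bar R)
    (pi_b pi_0 pi_star : policy R S A) (s_0 : S) (mu : fdist R S)
    (nu : policy R S A -> fdist R S) (m kappa alpha th : R) (K B : nat)
    (h_mirror : mirror_map h)
    (h_pi0 : forall s, rint (edom h) (vec (pi_0 s)))
    (h_explore : forall s a, 0 < pi_b s a)
    (h_ergodic : forall pi : policy R S A, ergodic_kernel (composed_kernel M pi_b pi))
    (h_lam : 0 < lam) (h_p : (1 <= p)%E)
    (h_strong : strongly_convex_simplex h lam p)
    (h_nu : forall pi : policy R S A, stationary (composed_kernel M pi_b pi) (nu pi))
    (h_m : 0 < m) (h_kappa : 0 < kappa < 1)
    (h_mixing : forall (pi : policy R S A) (s : S) (t : nat),
       tv_dist (nu pi) (kpow (composed_kernel M pi_b pi) t s) <= m * kappa ^+ t)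
    (h_alpha : 0 < alpha <= 1) (h_B : (0 < B)%N) (h_th : 0 <= th <= 1)
    (h_star : optimal_policy M pi_star)
    (h_Dfin : (policy_bregman_max h pi_star pi_0 < +oo)%E) :
  let gamma := discount M in
  let sigma := sigma_min pi_b nu in
  let D := fine (policy_bregman_max h pi_star pi_0) in
  let nA : R := #|A|%:R in
  let L := nA * ((Num.ceil (ln m^-1 / ln kappa))%:~R + (1 - kappa)^-1) in
  let eta := Num.sqrt ((alpha * lam * sigma ^+ 2 * (1 - gamma) ^+ 4 * D)
                        / ((6 + 4 * L) * nA ^+ 2 * K.+1%:R)) in
  (#|S| = 1%N -> 0 <= L) ->
  expect_random_iterate M h pi_b eta alpha B (geometric_weight B th)
      pi_0 s_0 K
      (fun pi => mean_at mu (opt_value M) - mean_at mu (value M pi))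
  <= 1 / K.+1%:R * (3 / (alpha * sigma * (1 - gamma) ^+ 3))
     + 2 / Num.sqrt K.+1%:R
       * Num.sqrt ((6 + 4 * L) * nA ^+ 2 * D
                    / (alpha * lam * sigma ^+ 2 * (1 - gamma) ^+ 6))
     + 2 / (sigma * (1 - gamma) ^+ 2) * Psi gamma B th m kappa.
Proof.
move=> gamma sigma D nA L eta hL1.
have q0 : 0 < 1 - gamma by rewrite subr_gt0 discount_lt1.
have q1 : 1 - gamma <= 1 by rewrite gerBl discount_ge0.
have /andP[alpha0 alpha1] := h_alpha; have /andP[th0 th1] := h_th.
have h_irr pi : irreducible_kernel (composed_kernel M pi_b pi) by case: (h_ergodic pi).
have sg0 : 0 < sigma := sigma_min_gt0 h_explore h_irr h_nu s_0.
have sg_le pi s a : sigma <= nu pi s * pi_b s a by exact: sigma_min_le.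
have S0 : (0 < #|S|)%N by apply/card_gt0P; exists s_0.
have A0 : (0 < #|A|)%N.
  rewrite lt0n; apply: contra_eqN (fdist_sum1 (pi_b s_0)) => /eqP A0.
  rewrite big_pred0 => [|a]; first by rewrite eq_sym oner_eq0.
  by case: (fintype0 a A0).
have nA1 : 1 <= nA by rewrite ler1n.
have sg1 : sigma <= 1.
  case/card_gt0P: A0 => a _; apply: le_trans (sg_le pi_b s_0 a) _.
  by rewrite mulr_ile1 ?fdist_ge0 ?fdist_le1.
have int0 s : (edom h)° (vec (pi_0 s)) by exact: mirror_rint.
have breg_le s : (policy_bregman h pi_star pi_0 s <= policy_bregman_max h pi_star pi_0)%E.
  exact: le_bigmax_cond.
have star_edom s : edom h (vec (pi_star s)).
  apply: (bregman_lty h_mirror (interior_edom (int0 s))).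
  exact: le_lt_trans (breg_le s) h_Dfin.
have bregE s : policy_bregman h pi_star pi_0 s =
    (real_bregman h (vec (pi_star s)) (vec (pi_0 s)))%:E.
  by apply: bregmanE => //; exact: interior_edom.
(* The state [s_0] keeps the maximum away from its default, minus infinity. *)
have DE : policy_bregman_max h pi_star pi_0 = D%:E.
  rewrite /D fineK // fin_numElt h_Dfin andbT.
  by apply: lt_le_trans (breg_le s_0); rewrite bregE ltNyr.
have D_ge s : real_bregman h (vec (pi_star s)) (vec (pi_0 s)) <= D.
  by rewrite -lee_fin -bregE -DE.
have D0 : 0 <= D by apply: le_trans (D_ge s_0); exact: bregman_interior_ge0.
have c_ge0 t := geometric_weight_ge0 B t th0.
have c_sum1 := geometric_weight_sum1 h_B th0.
have hPs := mixing_bias_le (discount_lt1 M) h_B h_th h_m h_kappa.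
have Ps0 : 0 <= Psi gamma B th m kappa.
  apply: le_trans hPs; rewrite divr_ge0 ?(ltW q0) // sumr_ge0 // => t _.
  by rewrite mulr_ge0 // mulr_ge0 ?exprn_ge0 ?ltW //; case/andP: h_kappa.
have [c [c0 cL lip]] := stationary_lipschitz h_nu h_kappa h_mixing S0 A0 hL1.
have W0 : 0 < (6 + 4 * L) * nA ^+ 2.
  by rewrite mulr_gt0 ?exprn_gt0 ?(lt_le_trans ltr01) //; rewrite -/nA -/L in cL; lra.
have N0 : 0 < K.+1%:R :> R by rewrite ltr0n.
pose x0 : @alg_state R S A := AlgState (fun _ _ => 0) pi_0 s_0.
have inv0 : alg_inv M h x0.
  by split=> // s a /=; rewrite lexx invr_ge0 ltW.
have inv_step x w := @alg_inv_step _ _ _ M h eta _ _ _ h_mirror h_alpha c_ge0 c_sum1 x w.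
pose cw := geometric_weight B th.
pose E := step_expectation M h pi_b eta alpha B cw.
pose F (x : @alg_state R S A) := gap M mu (alg_pi x).
rewrite expect_random_iterateE -/cw -/E -/x0 -/F.
have drift x : alg_inv M h x -> 0 <= eta -> forall s a,
    `|next_policy h eta x s a - alg_pi x s a| <= eta * (1 - gamma)^-1 * nA / lam.
  move=> [hpi hQ] eta0 s; apply: (pmd_update_drift h_mirror _ h_lam h_p h_strong) => // a.
  by have /andP[Q0 Q1] := hQ s a; rewrite ger0_norm.
(* D = 0 forces eta = 0 and pi_0 = pi_star, and the updates then never move. *)
have [Dz|Dpos] := leP D 0.
  have {}Dz : D = 0 by apply/le_anti; rewrite Dz.
  have eta0 : eta = 0 by rewrite /eta Dz mulr0 mul0r sqrtr0.
  pose I x := alg_inv M h x /\ alg_pi x = pi_star.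
  have I0 : I x0.
    split=> //=; apply/funext => s; apply: fdist_ext => a; apply/esym/eqP.
    have := strong_convexity_bregman h_mirror (ltW h_lam) h_p h_strong (star_edom s) (int0 s) a.
    move=> /le_trans/(_ (D_ge s)); rewrite Dz pmulr_rle0 ?divr_gt0 // => sq.
    by rewrite -subr_eq0 -sqrf_eq0 eq_le sq sqr_ge0.
  have Istep x (w : @batch S A B) : I x -> I (alg_step M h eta alpha cw x w).
    move=> [hx xs]; split; first exact: inv_step.
    rewrite -xs; apply/funext => s; apply: fdist_ext => a; apply/eqP.
    have := drift x hx; rewrite eta0 lexx !mul0r => /(_ isT s a).
    by rewrite normr_le0 subr_eq0.
  have F0 x : I x -> F x = 0.
    move=> [_ xs]; rewrite /F /gap xs -sumrB big1 // => s _.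
    by rewrite -mulrBr h_star subrr mulr0.
  have EF0 x : I x -> E F x <= 0 - E (fun=> 0) x + 0.
    move=> Ix; rewrite /E step_expectation_cst subrr addr0.
    by rewrite /step_expectation big1 // => w _; rewrite F0 ?mulr0 //; exact: Istep.
  have := drift_telescope (I := I) (Phi := fun=> 0) (lo := 0) (x := x0) K Istep EF0
    (fun _ _ => lexx 0) I0.
  rewrite mulr0 !addr0 subrr => le0.
  rewrite big_ord_recl /= F0 // add0r.
  apply: (@le_trans _ _ 0); first by rewrite mulr_ge0_le0 // invr_ge0 ltW.
  have a1 : 0 < alpha * sigma * (1 - gamma) ^+ 3 by rewrite !mulr_gt0 ?exprn_gt0.
  have a2 : 0 < sigma * (1 - gamma) ^+ 2 by rewrite mulr_gt0 ?exprn_gt0.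
  by rewrite !addr_ge0 ?mulr_ge0 ?invr_ge0 ?sqrtr_ge0 ?(ltW a1) ?(ltW a2) ?(ltW N0).
pose P := alpha * lam * sigma ^+ 2 * (1 - gamma) ^+ 4.
have P0 : 0 < P by rewrite !mulr_gt0 ?exprn_gt0.
have eta0 : 0 < eta by rewrite sqrtr_gt0 divr_gt0 // mulr_gt0.
have [] := optimal_step_size P0 W0 Dpos N0 q0; rewrite /= -/eta.
rewrite (_ : P * (1 - gamma) ^+ 2 = alpha * lam * sigma ^+ 2 * (1 - gamma) ^+ 6);
  last by rewrite /P; ring.
set T := Num.sqrt _ / Num.sqrt _ => T1 T2.
pose y := eta * (1 - gamma)^-1 * nA / lam.
have y0 : 0 <= y by rewrite !mulr_ge0 ?invr_ge0 // ltW.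
(* [y] bounds the change of each coordinate of a policy, so [nA * y] bounds its l_1 change. *)
pose U := 2 * (1 + c) * (nA * y) / (sigma ^+ 2 * (1 - gamma) ^+ 3).
have z0 : 0 <= nA * y by rewrite mulr_ge0.
have hU x : alg_inv M h x ->
    \sum_v `|dual_weight M pi_b pi_star mu nu (next_policy h eta x) v
             - dual_weight M pi_b pi_star mu nu (alg_pi x) v| <= U.
  move=> hx; have close : policy_close (alg_pi x) (next_policy h eta x) (nA * y).
    move=> s; rewrite mulr_natl -sumr_const; apply: ler_sum => a _.
    exact: (drift x hx (ltW eta0)).
  apply: dual_weight_close => //; exact: lip.
pose bb := U / (alpha * (1 - gamma)) + 2 / (sigma * (1 - gamma) ^+ 2) * Psi gamma B th m kappa.
have one x : alg_inv M h x -> E F x <=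
    potential M h pi_b pi_star mu nu eta alpha x
    - E (potential M h pi_b pi_star mu nu eta alpha) x + bb.
  by move=> hx; apply: (one_step_drift (m := m) (kappa := kappa)) => //; exact: hU.
have pot_ge x : alg_inv M h x -> - (2 / (alpha * sigma * (1 - gamma) ^+ 3))
    <= potential M h pi_b pi_star mu nu eta alpha x.
  by move=> hx; apply: potential_ge.
have tel := drift_telescope K inv_step one pot_ge inv0.
have pot0 : potential M h pi_b pi_star mu nu eta alpha x0 <= D / (eta * (1 - gamma)).
  rewrite /potential /pairing [X in _ - X / _]big1 => [|v _]; last by rewrite mulr0.
  rewrite mul0r subr0 invfM mulrA ![_ / eta]mulrC -[leRHS]mulrA ler_pM2l ?invr_gt0 //.
  rewrite -(occupancy_mass M pi_star mu) mulr_sumr; apply: ler_sum => s _.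
  by rewrite mulrC ler_wpM2r ?occupancy_ge0.
have g_0 : F x0 <= (1 - gamma)^-1 by exact: gap_le.
have a1 : 0 < alpha * sigma * (1 - gamma) ^+ 3 by rewrite !mulr_gt0 ?exprn_gt0.
(* The gap of the initial policy is put over the same denominator as the lower bound on the
   potential, turning 2 into 3. *)
have g_1 : (1 - gamma)^-1 <= 1 / (alpha * sigma * (1 - gamma) ^+ 3).
  rewrite div1r lef_pV2 ?posrE // exprS mulrCA ler_piMr ?(ltW q0) //.
  have q2 : (1 - gamma) ^+ 2 <= 1 by rewrite exprn_ile1 // ltW.
  have as1 : alpha * sigma <= 1 by rewrite mulr_ile1 // ltW.
  by rewrite mulr_ile1 ?exprn_ge0 ?mulr_ge0 ?(ltW alpha0) ?(ltW sg0) ?(ltW q0).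
have U_T : U / (alpha * (1 - gamma)) <= T.
  rewrite -T2 (_ : U / _ = 2 * (1 + c) * (nA * y / (sigma ^+ 2 * (1 - gamma) ^+ 3 *
    (alpha * (1 - gamma))))); last by rewrite /U; field; rewrite !gt_eqF.
  rewrite (_ : eta * _ / _ = (6 + 4 * L) * (nA * y / (sigma ^+ 2 * (1 - gamma) ^+ 3 *
    (alpha * (1 - gamma))))); last by rewrite /y /P; field; rewrite !gt_eqF.
  by rewrite ler_wpM2r // divr_ge0 // !mulr_ge0 ?exprn_ge0 // ltW.
have bb0 : 0 <= bb.
  rewrite addr_ge0 // ?mulr_ge0 // ?invr_ge0 ?mulr_ge0 ?exprn_ge0 ?(ltW alpha0)
    ?(ltW q0) ?(ltW sg0) //; lra.
have KN : K%:R * bb / K.+1%:R <= bb.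
  by rewrite mulrAC ler_piMl // ler_pdivrMr // mul1r ler_nat.
rewrite (_ : 2 / _ * _ = 2 * T); last by rewrite /T; ring.
(* The index 0 is split off: the telescoped sum covers only the K policies produced by updates. *)
rewrite big_ord_recl [iter _ _ _ _]/= mulrC -[leLHS]/((F x0 + _) / K.+1%:R).
set Sm := \sum_(i < K) _.
have {}tel : Sm <= potential M h pi_b pi_star mu nu eta alpha x0 -
  - (2 / (alpha * sigma * (1 - gamma) ^+ 3)) + K%:R * bb by exact: tel.
have total : (F x0 + Sm) / K.+1%:R <= (3 / (alpha * sigma * (1 - gamma) ^+ 3)
    + D / (eta * (1 - gamma)) + K%:R * bb) / K.+1%:R.
  rewrite ler_pM2r ?invr_gt0 //; move: tel pot0 g_0 g_1.
  by rewrite (_ : 3 / _ = 1 / (alpha * sigma * (1 - gamma) ^+ 3)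
    + 2 / (alpha * sigma * (1 - gamma) ^+ 3)) -?mulrDl; [lra|congr (_ / _); lra].
apply: le_trans total _; rewrite mulrDl [X in X + _ <= _]mulrDl.
rewrite -[D / _ / _]mulrA -invfM T1 mulrC div1r.
(* One copy of [T] comes from the initial divergence, the other bounds the drift part of [bb]. *)
have sum_le (a X V U' T' : R) : X <= U' + V -> U' <= T' -> a + T' + X <= a + 2 * T' + V.
  lra.
exact: sum_le KN U_T.
Qed.
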